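(* Let $X$ be a proper, geodesically complete $\mathrm{CAT}(0)$ space. If $X$ has the Gromov--Hausdorff asymptotic cone $C_{\infty}X$, then for every $p \in X$ there exists a sufficiently large $t_0 \in (0,\infty)$ such that for an arbitrary $t \in [t_0,\infty)$ the metric sphere $S_t(p)$ is homotopy equivalent to the Tits boundary $\partial_{\mathrm{T}}X$.
   Context: A metric space is proper if every closed bounded subset is compact. A geodesic metric space is geodesically complete if every geodesic can be extended to a local geodesic defined on $\mathbb{R}$. $S_t(p)=\{x\in X: d_X(p,x)=t\}$. Tits boundary: the ideal boundary $\partial_{\infty}X$ of a complete $\mathrm{CAT}(0)$ space $X$ is the set of classes of geodesic rays modulo being asymptotic (at bounded distance). For $p\in X$, $\xi\in\partial_\infty X$ there is a unique ray $p\xi$ from $p$ in the class $\xi$; $\angle_p(\xi,\eta)$ is the angle at $p$ between $p\xi$ and $p\eta$. The angle metric is $\angle(\xi,\eta) := \sup_{p\in X}\angle_p(\xi,\eta)$; the Tits metric $d_{\mathrm{T}}$ is the length metric induced from $\angle$ (possibly taking the value $\infty$). The Tits boundary $\partial_{\mathrm{T}}X$ is $\partial_\infty X$ with $d_{\mathrm{T}}$. Asymptotic cone: for $\lambda>0$, $\lambda X$ is $X$ with metric $\lambda d_X$. A sequence $(X_i,p_i)$ of pointed geodesic spaces converges to $(Y,q)$ in the pointed Gromov--Hausdorff topology if for every $r>0$ there are $\epsilon_i\to 0$ and $\epsilon_i$-approximations $\varphi_i\colon B_r(q)\to B_r(p_i)$ between closed balls with $\varphi_i(q)=p_i$ (a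 $c$-approximation is a map $\varphi$ such that the open $c$-balls around points of its image cover the target, and $|d(\varphi(x_1),\varphi(x_2))-d(x_1,x_2)|<c$ for all $x_1,x_2$). $X$ has the Gromov--Hausdorff asymptotic cone $(C_\infty X,p_\infty)=\lim_{\lambda\to0}(\lambda X,p)$ if for every sequence $\lambda_i\to 0$ in $(0,\infty)$ the pointed Gromov--Hausdorff limit $\lim_{i\to\infty}(\lambda_iX,p)$ exists and all these pointed limits are isometric to each other by isometries preserving base points; this does not depend on $p$. *)

(* Defs.v *)
From HB Require Import structures.
From mathcomp Require Import all_boot all_order all_algebra.
From mathcomp Require Import generic_quotient.
From mathcomp Require Import all_classical all_reals all_analysis.

Set Implicit Arguments.
Unset Strict Implicit.
Unset Printing Implicit Defensive.

Import Order.TTheory GRing.Theory Num.Theory.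
Import numFieldNormedType.Exports.

Local Open Scope classical_set_scope.
Local Open Scope ring_scope.
Local Open Scope quotient_scope.

Section MetricGeometry.
Context {R : realType}.

Definition mcball (X : metricType R) (p : X) (r : R) : set X :=
  [set x | mdist p x <= r].

Definition msphere (X : metricType R) (p : X) (t : R) : set X :=
  [set x | mdist p x = t].

Definition metric_bounded (X : metricType R) (A : set X) : Prop :=
  exists r : R, forall x y, A x -> A y -> mdist x y <= r.

Definition proper_space (X : metricType R) : Prop :=
  forall A : set X, closed A -> metric_bounded A -> compact A.

(* Curves are total functions R -> X of which only the restriction to the
   relevant parameter set is meaningful. *)
Definition isometric_on (X : metricType R) (I : set R) (c : R -> X) : Prop :=
  forall s t, I s -> I t -> mdist (c s) (c t) = `|s - t|.

Definition geodesic_segment (X : metricType R) (x y : X) (c : R -> X) : Prop :=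
  [/\ isometric_on `[0, mdist x y] c, c 0 = x & c (mdist x y) = y].

Definition geodesic_space (X : metricType R) : Prop :=
  forall x y : X, exists c : R -> X, geodesic_segment x y c.

Definition local_geodesic_line (X : metricType R) (c : R -> X) : Prop :=
  forall t, exists2 e : R, 0 < e & isometric_on `]t - e, t + e[ c.

(* Geodesics are parametrized by nondegenerate intervals of any kind; allowing
   degenerate ones would only exclude the one-point space. *)
Definition geodesically_complete (X : metricType R) : Prop :=
  forall (I : interval R) (c : R -> X),
    (exists s t : R, [/\ s \in I, t \in I & s < t]) ->
    isometric_on [set` I] c ->
    exists2 c' : R -> X, local_geodesic_line c' & {in I, c' =1 c}.

(* The norm of the library on R * R is the sup norm, hence [edist]. *)
Definition edist (a b : R * R) : R :=
  Num.sqrt ((a.1 - b.1) ^+ 2 + (a.2 - b.2) ^+ 2).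

Definition comparison_triangle (X : metricType R) (x y z : X)
    (x' y' z' : R * R) : Prop :=
  [/\ edist x' y' = mdist x y, edist y' z' = mdist y z
    & edist z' x' = mdist z x].

(* p lies on the side c from x to y, and p' is the corresponding point of the
   Euclidean segment [x', y'] *)
Definition comparison_point (X : metricType R) (x y : X) (c : R -> X)
    (x' y' : R * R) (p : X) (p' : R * R) : Prop :=
  exists t : R, [/\ 0 <= t <= 1, p = c (t * mdist x y)
                  & p' = (1 - t) *: x' + t *: y'].

Definition cat0_space (X : metricType R) : Prop :=
  geodesic_space X /\
  forall (x y z : X) (cxy cyz czx : R -> X) (x' y' z' : R * R),
    geodesic_segment x y cxy -> geodesic_segment y z cyz ->
    geodesic_segment z x czx -> comparison_triangle x y z x' y' z' ->
    let on_triangle p p' :=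
      [\/ comparison_point x y cxy x' y' p p',
          comparison_point y z cyz y' z' p p'
        | comparison_point z x czx z' x' p p'] in
    forall (p q : X) (p' q' : R * R),
      on_triangle p p' -> on_triangle q q' -> mdist p q <= edist p' q'.

(* the angle at p' in a comparison triangle for p, x, y (law of cosines) *)
Definition comparison_angle (X : metricType R) (p x y : X) : R :=
  acos ((mdist p x ^+ 2 + mdist p y ^+ 2 - mdist x y ^+ 2)
        / (2 * mdist p x * mdist p y)).

(* Alexandrov angle: limsup of the comparison angles as s, t -> 0+ *)
Definition alexandrov_angle (X : metricType R) (p : X) (c c' : R -> X) : R :=
  inf [set a | exists2 e : R, 0 < e &
    a = sup [set b | exists s t : R, [/\ 0 < s < e, 0 < t < e
                     & b = comparison_angle p (c s) (c' t)]]].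

End MetricGeometry.

(* Topology of an extended distance: U is open iff it contains a ball of
   positive radius around each of its points. *)
Definition dist_space (R : realType) (T : Type) (D : T -> T -> \bar R) : Type :=
  T.

Section DistSpace.
Context {R : realType} (T : choiceType) (D : T -> T -> \bar R).

HB.instance Definition _ := Choice.on (dist_space D).

Definition dist_open (U : set (dist_space D)) : Prop :=
  forall x, U x -> exists2 e : R, 0 < e & forall y, (D x y < e%:E)%E -> U y.

Let dist_openT : dist_open setT.
Proof. by move=> x _; exists 1. Qed.

Let dist_openI : setI_closed dist_open.
Proof.
move=> A B oA oB x [Ax Bx].
have [e1 e10 h1] := oA _ Ax; have [e2 e20 h2] := oB _ Bx.
exists (Num.min e1 e2) => [|y]; first by rewrite lt_min e10.
by rewrite EFin_min lt_min => /andP[? ?]; split; [exact: h1|exact: h2].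
Qed.

Let dist_open_bigU (I : Type) (f : I -> set (dist_space D)) :
  (forall i, dist_open (f i)) -> dist_open (\bigcup_i f i).
Proof.
move=> of_ x [i _ fx]; have [e e0 he] := of_ i _ fx.
by exists e => // y /he fy; exists i.
Qed.

HB.instance Definition _ := isOpenTopological.Build (dist_space D)
  dist_openT dist_openI dist_open_bigU.

Definition curve_length (c : R -> T) : \bar R :=
  ereal_sup [set l | exists2 s : seq R, itv_partition 0 1 s &
    let pt i := c (nth 0 (0 :: s) i) in
    l = (\sum_(0 <= i < size s) D (pt i) (pt i.+1))%E].

(* infimum of the D-lengths of the D-continuous curves from x to y;
   +oo if there is none *)
Definition length_metric (x y : T) : \bar R :=
  ereal_inf [set curve_length c | c in [set c : R -> dist_space D |
    [/\ {within `[0, 1], continuous c}, c 0 = x & c 1 = y]]].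

End DistSpace.

Section TitsBoundary.
Context {R : realType} (X : metricType R).

Record ray := Ray {
  ray_fun :> R -> X;
  ray_isometric : isometric_on `[0, +oo[ ray_fun }.

HB.instance Definition _ := gen_eqMixin ray.
HB.instance Definition _ := gen_choiceMixin ray.

Definition asymptotic (c c' : ray) : Prop :=
  exists K : R, forall t, 0 <= t -> mdist (c t) (c' t) <= K.

Let asymptotic_refl : reflexive (fun c c' => `[< asymptotic c c' >]).
Proof. by move=> c; apply/asboolP; exists 0 => t _; rewrite mdistxx. Qed.

Let asymptotic_sym : symmetric (fun c c' => `[< asymptotic c c' >]).
Proof.
move=> c c'; apply/asboolP/asboolP => -[K hK]; exists K => t t0;
  by rewrite metric_sym hK.
Qed.

Let asymptotic_trans : transitive (fun c c' => `[< asymptotic c c' >]).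
Proof.
move=> c' c c'' /asboolP[K hK] /asboolP[L hL]; apply/asboolP; exists (K + L).
by move=> t t0; rewrite (le_trans (metric_triangle _ (c' t) _))// lerD ?hK ?hL.
Qed.

Definition asymptotic_rel : equiv_rel ray :=
  EquivRel _ asymptotic_refl asymptotic_sym asymptotic_trans.

Definition ideal_boundary : choiceType := {eq_quot asymptotic_rel}.

(* The ray from p in the class xi. The default value repr xi is irrelevant in
   complete CAT(0) spaces, where this ray exists and is unique up to its
   values at negative parameters. *)
Definition ray_from (p : X) (xi : ideal_boundary) : ray :=
  xget (repr xi) [set c : ray | c 0 = p /\ \pi_ideal_boundary c = xi].

Definition angle_at (p : X) (xi eta : ideal_boundary) : R :=
  alexandrov_angle p (ray_from p xi) (ray_from p eta).

Definition angle_metric (xi eta : ideal_boundary) : R :=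
  sup [set angle_at p xi eta | p in [set: X]].

Definition tits_metric : ideal_boundary -> ideal_boundary -> \bar R :=
  length_metric (fun xi eta => (angle_metric xi eta)%:E).

Definition tits_boundary : topologicalType := dist_space tits_metric.

End TitsBoundary.

Definition rescale (R : realType) (l : {posnum R}) (X : Type) : Type := X.

Section Rescale.
Context {R : realType} (l : {posnum R}) (X : metricType R).

HB.instance Definition _ := Choice.on (rescale l X).

Let rdist (x y : rescale l X) : R := l%:num * mdist (x : X) (y : X).

Let rdistxx x : rdist x x = 0.
Proof. by rewrite /rdist mdistxx mulr0. Qed.

Let rdist_positivity x y : rdist x y = 0 -> x = y.
Proof.
by move/eqP; rewrite mulf_eq0 gt_eqF//= => /eqP /mdist_positivity.
Qed.

Let rdist_sym x y : rdist x y = rdist y x.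
Proof. by rewrite /rdist metric_sym. Qed.

Let rdist_triangle y x z : rdist x z <= rdist x y + rdist y z.
Proof. by rewrite /rdist -mulrDr ler_pM2l// metric_triangle. Qed.

HB.instance Definition _ := isMetric.Build R (rescale l X)
  rdistxx rdist_positivity rdist_sym rdist_triangle.

End Rescale.

Section AsymptoticCone.
Context {R : realType}.

(* phi restricts to a c-approximation A -> B *)
Definition approximation (X Y : metricType R) (c : R) (A : set X) (B : set Y)
    (phi : X -> Y) : Prop :=
  [/\ forall x, A x -> B (phi x),
      forall y, B y -> exists2 x, A x & mdist (phi x) y < c
    & forall x1 x2, A x1 -> A x2 ->
        `|mdist (phi x1) (phi x2) - mdist x1 x2| < c].

Definition pointed_GH_cvg (X_ : nat -> metricType R) (p_ : forall i, X_ i)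
    (Y : metricType R) (q : Y) : Prop :=
  forall r : R, 0 < r ->
    exists (eps : nat -> R) (phi : forall i, Y -> X_ i),
      eps i @[i --> \oo] --> 0 /\
      forall i, phi i q = p_ i /\
        approximation (eps i) (mcball q r) (mcball (p_ i) r) (phi i).

Definition pointed_isometric (Y Z : metricType R) (q : Y) (q' : Z) : Prop :=
  exists f : Y -> Z,
    [/\ bijective f, forall x y, mdist (f x) (f y) = mdist x y & f q = q'].

(* (Y, q) is the pointed Gromov-Hausdorff limit of (l_i X, p). Limits are
   taken among proper geodesic spaces, where they are unique up to pointed
   isometry; without completeness they would not be. *)
Definition rescaling_limit (X : metricType R) (p : X) (l : nat -> {posnum R})
    (Y : metricType R) (q : Y) : Prop :=
  [/\ proper_space Y, geodesic_space Y &
      @pointed_GH_cvg (fun i => rescale (l i) X) (fun=> p) Y q].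

Definition has_asymptotic_cone_at (X : metricType R) (p : X) : Prop :=
  (forall l : nat -> {posnum R}, (l i)%:num @[i --> \oo] --> (0 : R) ->
     exists (Y : metricType R) (q : Y), rescaling_limit p l q) /\
  (forall (l l' : nat -> {posnum R}) (Y Y' : metricType R) (q : Y) (q' : Y'),
     (l i)%:num @[i --> \oo] --> (0 : R) ->
     (l' i)%:num @[i --> \oo] --> (0 : R) ->
     rescaling_limit p l q -> rescaling_limit p l' q' ->
     pointed_isometric q q').

(* the condition does not depend on the base point *)
Definition has_asymptotic_cone (X : metricType R) : Prop :=
  exists p : X, has_asymptotic_cone_at p.

End AsymptoticCone.

(* A homotopy is a map on A * R continuous on A * [0, 1]. *)
Definition homotopic (R : realType) (A B : topologicalType) (f g : A -> B) :
    Prop :=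
  exists H : A * R -> B,
    [/\ {within [set: A] `*` `[0, 1], continuous H},
        forall x, H (x, 0) = f x & forall x, H (x, 1) = g x].

Definition homotopy_equivalent (R : realType) (A B : topologicalType) : Prop :=
  exists (f : A -> B) (g : B -> A),
    [/\ continuous f, continuous g,
        homotopic R (g \o f) idfun & homotopic R (f \o g) idfun].

(* Main.v *)
Require Import Defs.
From mathcomp Require Import all_boot all_order all_algebra.
From mathcomp Require Import generic_quotient ring lra.
From mathcomp Require Import all_classical all_reals all_analysis.

Set Implicit Arguments.
Unset Strict Implicit.
Unset Printing Implicit Defensive.

Import Order.TTheory GRing.Theory Num.Theory.
Import numFieldNormedType.Exports.

Local Open Scope classical_set_scope.
Local Open Scope ring_scope.

(** Why the theorem holds.  Fix the base point p.  Every point of S_t(p) lies on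
    a ray from p, because geodesics extend to local geodesics and these are
    geodesics in a CAT(0) space; so evaluating rays at time t maps the ideal
    boundary onto S_t(p).  The claim is that this map, which is
    continuous for the Tits topology, is a homotopy equivalence for large t.

    The boundary is measured by the chord metric
      chord xi eta = lim d(xi(t), eta(t)) / t = 2 sin (angle xi eta / 2),
    a nondecreasing limit.  It induces the Tits topology (tits_near,
    continuous_to_tits), and it is the restriction to the unit sphere of the
    limit metric cdist on the set of all rays from p of any constant speed
    v >= 0.  That set is the Euclidean cone over the boundary; it inherits the
    CN inequality of Bruhat and Tits from X (cone_convex), so it has weighted
    means and geodesics depending continuously on their endpoints.

    The asymptotic cone enters only through compactness.  If the boundary
    contained n points at mutual chord distance r for every n, the balls of
    (X / t_n, p), for suitable t_n tending to infinity, would contain n points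
    at mutual distance r / 2, and no limit of these spaces could be proper.
    So the boundary is totally bounded for the chord metric, and since
    d(xi(t), eta(t)) / t increases to the chord, the convergence is uniform
    (uniform_net).

    The homotopy inverse phi sends x = eta(t) to the direction of a weighted
    mean, in the Euclidean cone, of the points of a finite net whose rays are
    near x at time t.  By uniformity, phi x is close to eta in the chord metric
    (boundary_section).  Hence the composite on the boundary is homotopic to
    the identity along geodesics of the Euclidean cone, projected to the unit
    sphere (join_exists).

    On the sphere the difficulty is that pushing points radially outwards is
    not well defined in X.  It is avoided by joining x = eta(t) to the point
    z = (phi x)(2t): as z is within t / 2 of eta(2t), and the distance to p
    grows at unit speed on the segment from x to eta(2t), comparison shows that
    the segment from x to z stays outside the open ball of radius t.  Projecting
    this segment radially inwards to S_t(p), which is canonical, gives a path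
    from x to (phi x)(t) that depends continuously on x. *)

(** * Elementary real estimates *)

Section RealAux.
Context {R : realType}.
Implicit Types x y s t : R.

Lemma le_of_sqr x y : 0 <= y -> x ^+ 2 <= y ^+ 2 -> x <= y.
Proof. by move=> y0; rewrite leNgt => h; rewrite leNgt; apply: contra h => h; rewrite ltr_pXn2r// nnegrE; lra. Qed.

Lemma le_of_eq x y : x = y -> x <= y.
Proof. by move=> ->. Qed.

Lemma le_of_small x y k : 0 <= k -> (forall e, 0 < e -> x <= y + k * e) -> x <= y.
Proof.
move=> k0 h; apply/ler_addgt0Pr => e e0.
have k1 : 0 < k + 1 by lra.
apply: le_trans (h (e / (k + 1)) _) _; first by rewrite divr_gt0.
rewrite lerD2l mulrA ler_pdivrMr// mulrC.
by rewrite ler_pM2l//; lra.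
Qed.

Lemma eq_of_small x y k : 0 <= k -> (forall e, 0 < e -> `|x - y| <= k * e) -> x = y.
Proof.
move=> k0 h; apply/eqP; rewrite eq_le.
by apply/andP; split; apply: (le_of_small k0) => e /h; rewrite ler_norml; lra.
Qed.

Definition clamp s : R := Num.max 0 (Num.min 1 s).

Lemma clamp_itv s : 0 <= clamp s <= 1.
Proof. by rewrite le_max lexx ge_max ler01 ge_min lexx. Qed.

Lemma clamp0 : clamp 0 = 0.
Proof. by rewrite /clamp min_r// maxxx. Qed.

Lemma clamp1 : clamp 1 = 1.
Proof. by rewrite /clamp minxx max_r. Qed.

Lemma itv01_0 : (0 : R) <= 0 <= (1 : R). Proof. by rewrite lexx ler01. Qed.
Lemma itv01_1 : (0 : R) <= 1 <= (1 : R). Proof. by rewrite lexx ler01. Qed.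

Lemma clampE s : [\/ s <= 0 /\ clamp s = 0, 0 <= s <= 1 /\ clamp s = s
  | 1 <= s /\ clamp s = 1].
Proof.
rewrite /clamp; have [s1|s1] := leP 1 s.
  by apply: Or33; rewrite max_r.
have [s0|s0] := leP 0 s; first by apply: Or32; split=> //; rewrite ltW.
by apply: Or31; rewrite ltW.
Qed.

Lemma clamp_lip s t : `|clamp s - clamp t| <= `|s - t|.
Proof.
rewrite ler_norml; have : - `|s - t| <= s - t <= `|s - t|.
  by rewrite -ler_norml.
have := normr_ge0 (s - t); move: `|_| => u.
by case: (clampE s) => -[? ->]; case: (clampE t) => -[? ->]; lra.
Qed.

Lemma near_dist s (e : R) : 0 < e -> \forall t \near s, `|s - t| < e.
Proof.
by move=> e0; apply: (@cvgr_dist_lt _ _ _ (nbhs s) _ id s) => //; exact: cvg_id.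
Qed.

End RealAux.

(** * Spaces with the CN inequality *)

(** The distance d is only assumed to be a pseudometric, so that the theory
    applies both to X and to the space of rays from a point.  G x y s stands for
    the point at ratio s on a geodesic from x to y; the last axiom is the
    inequality of Bruhat and Tits for all ratios, and all the CAT(0) geometry
    below derives from it. *)
Record convex_metric (R : realType) (T : Type) (d : T -> T -> R)
    (G : T -> T -> R -> T) : Prop := ConvexMetric {
  cm_xx : forall x, d x x = 0;
  cm_sym : forall x y, d x y = d y x;
  cm_tri : forall y x z, d x z <= d x y + d y z;
  cm_cn : forall x y z s, 0 <= s <= 1 ->
    d z (G x y s) ^+ 2 <=
      (1 - s) * d z x ^+ 2 + s * d z y ^+ 2 - s * (1 - s) * d x y ^+ 2 }.

Section ConvexMetricTheory.
Context {R : realType} (T : Type) (d : T -> T -> R) (G : T -> T -> R -> T).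
Hypothesis H : convex_metric d G.
Implicit Types (x y z w : T) (s u : R).

Let dxx := cm_xx H.
Let dC := cm_sym H.
Let dT := cm_tri H.
Let dG := cm_cn H.

Lemma cm_ge0 x y : 0 <= d x y.
Proof. by have := dT y x x; rewrite dxx (dC y x); lra. Qed.

Lemma cm_left x y s : 0 <= s <= 1 -> d x (G x y s) <= s * d x y.
Proof.
move=> /[dup] s01 /andP[s0 s1]; apply: le_of_sqr; first by rewrite mulr_ge0// cm_ge0.
by apply: le_trans (dG x y x s01) _; rewrite dxx; lra.
Qed.

Lemma cm_right x y s : 0 <= s <= 1 -> d y (G x y s) <= (1 - s) * d x y.
Proof.
move=> /[dup] s01 /andP[s0 s1]; apply: le_of_sqr; first by rewrite mulr_ge0 ?cm_ge0//; lra.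
by apply: le_trans (dG x y y s01) _; rewrite dxx (dC y x); lra.
Qed.

Lemma cm_left_eq x y s : 0 <= s <= 1 -> d x (G x y s) = s * d x y.
Proof.
move=> s01; apply/eqP; rewrite eq_le cm_left//=.
by have := dT (G x y s) x y; have := cm_right x y s01; rewrite (dC y); lra.
Qed.

(** CN at a point w satisfying both bounds has a nonpositive right-hand side. *)
Lemma cm_unique x y w s : 0 <= s <= 1 ->
  d x w <= s * d x y -> d y w <= (1 - s) * d x y -> d w (G x y s) = 0.
Proof.
move=> /[dup] s01 /andP[s0 s1] hx hy; apply/eqP; rewrite -sqrf_eq0 eq_le sqr_ge0 andbT.
apply: le_trans (dG x y w s01) _; rewrite (dC w x) (dC w y).
have d0 := cm_ge0 x y.
have hx2 : d x w ^+ 2 <= (s * d x y) ^+ 2 by rewrite ler_pXn2r// nnegrE ?mulr_ge0 ?cm_ge0.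
have hy2 : d y w ^+ 2 <= ((1 - s) * d x y) ^+ 2.
  by rewrite ler_pXn2r// nnegrE ?mulr_ge0 ?cm_ge0//; lra.
have s1' : 0 <= 1 - s by lra.
have := ler_wpM2l s1' hx2; have := ler_wpM2l s0 hy2; lra.
Qed.

(** Comparison for two points on two sides of a triangle with apex p.  The
    right-hand side is the squared distance of the corresponding points of a
    Euclidean triangle, expanded by the law of cosines. *)
Lemma cm_triangle_sqr p x y s u : 0 <= s <= 1 -> 0 <= u <= 1 ->
  d (G p x s) (G p y u) ^+ 2 <=
    d p x ^+ 2 * (s ^+ 2 - s * u) + d p y ^+ 2 * (u ^+ 2 - s * u)
    + s * u * d x y ^+ 2.
Proof.
move=> /[dup] s01 /andP[s0 s1] /[dup] u01 /andP[u0 u1].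
have u1' : 0 <= 1 - u by lra.
apply: le_trans (dG p y _ u01) _.
have h1 : d (G p x s) p ^+ 2 <= (s * d p x) ^+ 2.
  by rewrite ler_pXn2r ?nnegrE ?mulr_ge0 ?cm_ge0// dC; exact: cm_left.
have h2 := dG p x y s01; rewrite dC.
have := ler_wpM2l u1' h1; have := ler_wpM2l u0 h2.
rewrite (dC y p) (dC y x) (dC p (G p x s)) (dC y (G p x s)); lra.
Qed.

Lemma cm_param x y s u : 0 <= s <= 1 -> 0 <= u <= 1 ->
  d (G x y s) (G x y u) <= `|s - u| * d x y.
Proof.
move=> s01 u01; apply: le_of_sqr; first by rewrite mulr_ge0// cm_ge0.
apply: le_trans (cm_triangle_sqr x y y s01 u01) _.
by rewrite dxx exprMn -normrX ger0_norm ?sqr_ge0//; lra.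
Qed.

Lemma cm_param_eq x y s u : 0 <= s <= 1 -> 0 <= u <= 1 ->
  d (G x y s) (G x y u) = `|s - u| * d x y.
Proof.
move=> s01 u01; apply/eqP; rewrite eq_le cm_param//=.
wlog su : s u s01 u01 / s <= u.
  move=> hw; have [su|/ltW us] := leP s u; first exact: hw.
  by rewrite (dC (G x y s)) distrC; exact: hw.
rewrite ler0_norm; last lra.
have := dT (G x y s) x y; have := dT (G x y u) (G x y s) y.
have := cm_left x y s01; have := cm_right x y u01; rewrite (dC y); lra.
Qed.

Lemma cm_shared p x y s : 0 <= s <= 1 -> d (G p x s) (G p y s) <= s * d x y.
Proof.
move=> /[dup] s01 /andP[s0 s1]; apply: le_of_sqr; first by rewrite mulr_ge0// cm_ge0.
by apply: le_trans (cm_triangle_sqr p x y s01 s01) _; lra.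
Qed.

Lemma cm_rev x y s : 0 <= s <= 1 -> d (G x y s) (G y x (1 - s)) = 0.
Proof.
move=> /[dup] s01 /andP[s0 s1].
have s01' : 0 <= 1 - s <= 1 by lra.
rewrite dC; apply: cm_unique => //.
- by apply: le_trans (cm_right _ _ s01') _; rewrite (dC y x); lra.
- by apply: le_trans (cm_left _ _ s01') _; rewrite (dC y x); lra.
Qed.

(** The distance is convex along pairs of geodesics: cut the quadrilateral into
    two triangles by the diagonal from x to y'. *)
Lemma cm_convex x y x' y' s : 0 <= s <= 1 ->
  d (G x y s) (G x' y' s) <= (1 - s) * d x x' + s * d y y'.
Proof.
move=> /[dup] s01 /andP[s0 s1].
have s01' : 0 <= 1 - s <= 1 by lra.
have h1 : d (G x y s) (G x y' s) <= s * d y y' by exact: cm_shared.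
have h2 : d (G x y' s) (G x' y' s) <= (1 - s) * d x x'.
  apply: le_trans (dT (G y' x (1 - s)) _ _) _; rewrite cm_rev// add0r.
  apply: le_trans (dT (G y' x' (1 - s)) _ _) _.
  by rewrite [d _ (G x' y' s)]dC cm_rev// addr0; exact: cm_shared.
by apply: le_trans (dT (G x y' s) _ _) _; rewrite addrC; exact: lerD.
Qed.

Lemma cm_lip x y x' y' s u : 0 <= s <= 1 -> 0 <= u <= 1 ->
  d (G x y s) (G x' y' u) <= d x x' + d y y' + `|s - u| * d x' y'.
Proof.
move=> /[dup] s01 /andP[s0 s1] u01.
apply: le_trans (dT (G x' y' s) _ _) _; apply: lerD; last exact: cm_param.
apply: le_trans (cm_convex _ _ _ _ s01) _.
have := ler_wpM2r (cm_ge0 y y') s1.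
have s1' : 1 - s <= 1 by lra.
have := ler_wpM2r (cm_ge0 x x') s1'; lra.
Qed.

Lemma cm_ball z x y s r : 0 <= s <= 1 -> d z x <= r -> d z y <= r ->
  d z (G x y s) <= r.
Proof.
move=> /[dup] s01 /andP[s0 s1] zx zy.
have r0 : 0 <= r by apply: le_trans zx; exact: cm_ge0.
apply: le_of_sqr => //; apply: le_trans (dG x y z s01) _.
have hx : d z x ^+ 2 <= r ^+ 2 by rewrite ler_pXn2r// nnegrE cm_ge0.
have hy : d z y ^+ 2 <= r ^+ 2 by rewrite ler_pXn2r// nnegrE cm_ge0.
have s1' : 0 <= 1 - s by lra.
have := ler_wpM2l s1' hx; have := ler_wpM2l s0 hy.
have := mulr_ge0 (mulr_ge0 s0 s1') (sqr_ge0 (d x y)); lra.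
Qed.

(** ** Weighted means *)

Section Barycenter.
Context (A : topologicalType) (x0 : T).
Implicit Types (l : seq (T * (A -> R))) (a : A).

Definition wt l a : R := \sum_(i <- l) i.2 a.

(** Means are taken one point at a time along the list.  At a parameter where all
    the weights vanish the ratio is 0 / 0 = 0 and the value is meaningless;
    there bary is in general discontinuous. *)
Fixpoint bary l a : T :=
  if l is i :: l' then G (bary l' a) i.1 (i.2 a / (i.2 a + wt l' a)) else x0.

Lemma wt_ge0 l a : (forall i, List.In i l -> 0 <= i.2 a) -> 0 <= wt l a.
Proof.
rewrite /wt; elim: l => [_|i l IH h]; first by rewrite big_nil.
by rewrite big_cons addr_ge0//; [apply: h; left|apply: IH => j jl; apply: h; right].
Qed.

Lemma ratio01 (u v : R) : 0 <= u -> 0 <= v -> 0 <= u / (u + v) <= 1.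
Proof.
move=> u0 v0; rewrite divr_ge0 ?addr_ge0//=.
have [->|n0] := eqVneq (u + v) 0; first by rewrite invr0 mulr0.
by rewrite ler_pdivrMr ?mul1r ?lerDl// lt_def n0 addr_ge0.
Qed.

Lemma bary_ball l a z r : (forall i, List.In i l -> 0 <= i.2 a) ->
  (forall i, List.In i l -> 0 < i.2 a -> d z i.1 <= r) -> 0 < wt l a ->
  d z (bary l a) <= r.
Proof.
elim: l => [|[y f] l IH] h0 hr; rewrite /wt; first by rewrite big_nil ltxx.
rewrite big_cons -/(wt l a)/= => W0.
have f0 : 0 <= f a by apply: (h0 (y, f)); left.
have Wl0 : 0 <= wt l a by apply: wt_ge0 => i il; apply: h0; right.
have [Wl|Wl] := ltP 0 (wt l a); last first.
  have {Wl} Wl : wt l a = 0 by apply/eqP; rewrite eq_le Wl.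
  rewrite Wl addr0 in W0 *; rewrite divff ?gt_eqF//.
  apply: le_trans (dT y _ _) _.
  have := cm_right (bary l a) y (_ : 0 <= 1 <= 1); rewrite subrr mul0r ler01 lexx.
  by move=> /(_ isT); have := hr (y, f) (or_introl erefl) W0; rewrite /=; lra.
have IHr : d z (bary l a) <= r.
  by apply: IH => // i il; [apply: h0; right|apply: hr; right].
have [fa|fa] := ltP 0 (f a).
  by apply: cm_ball IHr _; [exact: ratio01|exact: (hr (y, f) (or_introl erefl))].
have -> : f a = 0 by apply/eqP; rewrite eq_le fa.
rewrite mul0r; apply: le_trans (dT (bary l a) _ _) _.
have := cm_left (bary l a) y (_ : 0 <= 0 <= 1); rewrite mul0r ler01 lexx.
by move=> /(_ isT); lra.
Qed.

Lemma bary_bounded l : (forall i, List.In i l -> forall a, 0 <= i.2 a) ->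
  exists B, forall a, d x0 (bary l a) <= B.
Proof.
elim: l => [_|[y f] l IH h0]; first by exists 0 => a; rewrite /= dxx.
have [i il a|B hB] := IH; first by apply: h0; right.
exists (Num.max B (d x0 y)) => a /=; apply: cm_ball.
- apply: ratio01; first by apply: (h0 (y, f)); left.
  by apply: wt_ge0 => i il; apply: h0; right.
- by rewrite le_max hB.
- by rewrite le_max lexx orbT.
Qed.

Lemma wt_cont l : (forall i, List.In i l -> continuous i.2) -> continuous (wt l).
Proof.
elim: l => [_|[y f] l IH hc] a.
  rewrite (_ : wt [::] = fun=> 0); first exact: cvg_cst.
  by apply/funext => b; rewrite /wt big_nil.
rewrite (_ : wt _ = f \+ wt l); last by apply/funext => b; rewrite /wt big_cons.
apply: cvgD; first by apply: (hc (y, f)); left.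
by apply: IH => i il; apply: hc; right.
Qed.

(** At a step where the weight of the earlier points vanishes, the earlier mean
    is arbitrary and may jump, but it stays in a bounded set and the ratio given
    to the new point tends to 1, so the new mean is still continuous. *)
Lemma bary_cont l a : (forall i, List.In i l -> forall a, 0 <= i.2 a) ->
  (forall i, List.In i l -> continuous i.2) -> 0 < wt l a ->
  forall e, 0 < e -> \forall b \near a, d (bary l a) (bary l b) < e.
Proof.
move=> + + + e.
elim: l e => [|[y f] l IH] e h0 hc; rewrite /wt; first by rewrite big_nil ltxx.
rewrite big_cons -/(wt l a)/= => W0 e0.
have h0l i : List.In i l -> forall a, 0 <= i.2 a by move=> il; apply: h0; right.
have hcl i : List.In i l -> continuous i.2 by move=> il; apply: hc; right.
have f0 b : 0 <= f b by apply: (h0 (y, f)); left.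
have Wl0 b : 0 <= wt l b by apply: wt_ge0 => i il; apply: h0l.
pose q b := f b / (f b + wt l b).
have q01 b : 0 <= q b <= 1 by exact: ratio01.
have qc : {for a, continuous q}.
  have fc : {for a, continuous f} by apply: (hc (y, f)); left.
  apply: cvgM => //; apply: cvgV; first by rewrite gt_eqF.
  by apply: cvgD => //; exact: wt_cont.
have [B hB] := bary_bounded h0l.
have d_yb b : d (bary l b) y <= B + d x0 y.
  by have := dT x0 (bary l b) y; have := hB b; rewrite (dC _ x0); lra.
have By0 : 0 <= B + d x0 y by apply: le_trans (d_yb a); exact: cm_ge0.
have e2 : 0 < e / 2 by lra.
have qnear (k : R) : 0 < k -> \forall b \near a, `|q a - q b| < k.
  by move=> k0; move/cvgrPdist_lt : qc; apply.
(* B + d x0 y bounds the length of the segment on which the mean moves *)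
pose k := e / 2 / (B + d x0 y + 1).
have k0 : 0 < k by rewrite divr_gt0//; lra.
have kB (v : R) : 0 <= v -> v < k -> v * (B + d x0 y) < e / 2.
  move=> v0; rewrite ltr_pdivlMr; last lra.
  by apply: le_lt_trans; rewrite ler_wpM2l// lerDl.
have [Wl|Wl] := ltP 0 (wt l a).
  near=> b.
  apply: le_lt_trans (cm_lip _ _ _ _ (q01 a) (q01 b)) _.
  rewrite dxx addr0 [ltRHS]splitr; apply: ltrD.
    by near: b; exact: IH.
  apply: (@le_lt_trans _ _ (`|q a - q b| * (B + d x0 y))).
    by rewrite ler_wpM2l.
  by apply: kB => //; near: b; exact: qnear.
have {Wl} Wl : wt l a = 0 by apply/eqP; rewrite eq_le Wl Wl0.
have qa : q a = 1 by move: W0; rewrite /q Wl addr0 => fa; rewrite divff// gt_eqF.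
near=> b.
apply: le_lt_trans (dT y _ _) _.
rewrite -/(q a) -/(q b) qa.
have h1 : d (G (bary l a) y 1) y = 0.
  apply/eqP; rewrite eq_le cm_ge0 andbT dC.
  by have := cm_right (bary l a) y (_ : 0 <= 1 <= 1); rewrite subrr mul0r ler01 lexx => /(_ isT).
rewrite h1 add0r; apply: le_lt_trans (cm_right _ _ (q01 b)) _.
apply: (@le_lt_trans _ _ (`|q a - q b| * (B + d x0 y))).
  by rewrite qa ler_pM// ?cm_ge0 ?ler_norm//; have /andP[] := q01 b; lra.
apply: (@lt_trans _ _ (e / 2)); last lra.
by apply: kB => //; near: b; exact: qnear.
Unshelve. all: by end_near. Qed.

End Barycenter.
End ConvexMetricTheory.

(** * CAT(0) spaces *)

Section Cat0.
Context {R : realType} (X : metricType R).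
Implicit Types (x y z p q : X) (s t u : R).

Lemma edist_sqr (a b : R * R) :
  Defs.edist a b ^+ 2 = (a.1 - b.1) ^+ 2 + (a.2 - b.2) ^+ 2.
Proof. by rewrite sqr_sqrtr// addr_ge0// sqr_ge0. Qed.

Lemma comparison_triangle_exists x y z :
  exists x' y' z' : R * R, comparison_triangle x y z x' y' z'.
Proof.
have edistE (a b : R * R) k : 0 <= k ->
    (a.1 - b.1) ^+ 2 + (a.2 - b.2) ^+ 2 = k ^+ 2 -> Defs.edist a b = k.
  by move=> k0 E; rewrite /Defs.edist E sqrtr_sqr ger0_norm.
have [xy|xy] := eqVneq x y.
  exists (0, 0), (0, 0), (mdist x z, 0); rewrite -xy; split; apply: edistE;
    rewrite ?mdist_ge0//= ?mdistxx; first by ring.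
  - by ring.
  - by rewrite metric_sym; ring.
have a0 : 0 < mdist x y by rewrite mdist_gt0.
set a := mdist x y in a0 *; set b := mdist y z; set c := mdist z x.
have abc : a <= c + b.
  by have := metric_triangle x z y; rewrite (metric_sym x z) (metric_sym z y).
have bac : b <= a + c.
  by have := metric_triangle y x z; rewrite (metric_sym y x) (metric_sym x z).
have cab : c <= a + b.
  by have := metric_triangle z y x; rewrite (metric_sym z y) (metric_sym y x) addrC.
have b0 : 0 <= b by exact: mdist_ge0.
have c0 : 0 <= c by exact: mdist_ge0.
pose k := (a ^+ 2 + c ^+ 2 - b ^+ 2) / (2 * a).
have kE : 2 * a * k = a ^+ 2 + c ^+ 2 - b ^+ 2 by rewrite /k; field; rewrite gt_eqF.
have kc : k ^+ 2 <= c ^+ 2.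
  have a2 : 0 < (2 * a) ^+ 2 by rewrite exprn_gt0//; lra.
  rewrite -(ler_pM2l a2) -exprMn kE.
  have h1 : 0 <= c + b - a by lra.
  have h2 : 0 <= a + c - b by lra.
  have h3 : 0 <= a + b - c by lra.
  have h4 : 0 <= a + b + c by lra.
  have := mulr_ge0 (mulr_ge0 h1 h2) (mulr_ge0 h3 h4); lra.
have v2 : Num.sqrt (c ^+ 2 - k ^+ 2) ^+ 2 = c ^+ 2 - k ^+ 2.
  by rewrite sqr_sqrtr// subr_ge0.
exists (0, 0), (a, 0), (k, Num.sqrt (c ^+ 2 - k ^+ 2)).
split; apply: edistE; rewrite ?mdist_ge0//= -/a -/b -/c; first by ring.
- by have := v2; lra.
- by have := v2; lra.
Qed.

Hypothesis cat0 : cat0_space X.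

(** In the comparison triangle CN is an equality (Stewart's theorem), and z and
    the point of the side from x to y are at most as far apart in X. *)
Lemma cat0_cn x y z c s : geodesic_segment x y c -> 0 <= s <= 1 ->
  mdist z (c (s * mdist x y)) ^+ 2 <=
    (1 - s) * mdist z x ^+ 2 + s * mdist z y ^+ 2
    - s * (1 - s) * mdist x y ^+ 2.
Proof.
move=> gc s01; have [geo cmp] := cat0.
have [cyz gyz] := geo y z; have [czx gzx] := geo z x.
have [x' [y' [z' tri]]] := comparison_triangle_exists x y z.
have := cmp _ _ _ _ _ _ _ _ _ gc gyz gzx tri z (c (s * mdist x y)) z'
  ((1 - s) *: x' + s *: y').
have -> : (1 - s) * mdist z x ^+ 2 + s * mdist z y ^+ 2
    - s * (1 - s) * mdist x y ^+ 2 = Defs.edist z' ((1 - s) *: x' + s *: y') ^+ 2.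
  have [<- E <-] := tri; rewrite metric_sym -E !edist_sqr /=.
  by rewrite /GRing.scale/=; ring.
move=> h; rewrite ler_pXn2r ?nnegrE ?sqrtr_ge0 ?mdist_ge0//; apply: h.
- apply: Or33; exists 0; rewrite lexx ler01 mul0r subr0 scale1r scale0r addr0.
  by split=> //; have [_ ->] := gzx.
- by apply: Or31; exists s.
Qed.

Lemma cat0_convex_metric : exists G : X -> X -> R -> X, convex_metric mdist G.
Proof.
have [geo _] := cat0.
have [g gP] := choice (fun xy : X * X => geo xy.1 xy.2).
exists (fun x y s => g (x, y) (s * mdist x y)).
split; [exact: mdistxx|exact: metric_sym|by move=> *; exact: metric_triangle|].
by move=> x y z s s01; apply: cat0_cn => //; exact: (gP (x, y)).
Qed.

(** If c is isometric on [a, m] and near m, then CN at the midpoint c m of the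
    short segment from c (m - h) to c (m + h), seen from c a, gives
    d(c a, c (m + h)) >= m + h - a, so c is isometric on [a, m + h].  A supremum
    argument concludes. *)
Lemma local_geodesic_isometric (c : R -> X) : local_geodesic_line c ->
  forall a b, a <= b -> isometric_on `[a, b] c.
Proof.
move=> loc a b ab; have [G GP] := cat0_convex_metric.
pose S : set R := [set m | a <= m /\ isometric_on `[a, m] c].
have Sa : S a.
  split=> // s t; rewrite /= !in_itv/= => /andP[h1 h2] /andP[h3 h4].
  have -> : s = t by lra.
  by rewrite mdistxx subrr normr0.
have Sdown m m' : S m -> a <= m' <= m -> S m'.
  move=> [am iso] /andP[am' mm']; split=> // s t.
  rewrite /= !in_itv/= => /andP[h1 h2] /andP[h3 h4].
  by apply: iso; rewrite /= in_itv/=; lra.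
apply: contrapT => nb.
have ubS : ubound S b.
  move=> m Sm; rewrite leNgt; apply/negP => bm; apply: nb.
  by have [] := Sdown _ b Sm; rewrite ?ab ?ltW.
have supS : has_sup S by split; [exists a|exists b].
set B := sup S.
have aB : a <= B by apply: ub_le_sup Sa; exists b.
have [e e0 iso] := loc B.
(* every m in S close to B extends past B *)
suff [m' mB' Sm'] : exists2 m', B < m' & S m'.
  have : m' <= B by apply: ub_le_sup Sm'; exists b.
  by rewrite leNgt mB'.
have e4 : 0 < e / 4 by lra.
have [m Sm mB] := @sup_adherent _ S (e / 4) e4 supS; rewrite -/B in mB.
have mB0 : m <= B by apply: ub_le_sup Sm; exists b.
have [am isom] := Sm.
exists (m + e / 2); first lra.
split; first lra.
have [aBe|aBe] := ltP (B - e) a.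
  move=> s t; rewrite /= !in_itv/= => /andP[h1 h2] /andP[h3 h4].
  by apply: iso; rewrite /= in_itv/=; lra.
pose h := e / 2; have hE : h = e / 2 by [].
have d1 : mdist (c (m - h)) (c (m + h)) = 2 * h.
  by rewrite iso /= ?in_itv/= ?ler0_norm; lra.
have d2 : mdist (c m) (c (m + h)) = h.
  by rewrite iso /= ?in_itv/= ?ler0_norm; lra.
have d3 : mdist (c (m - h)) (c m) = h.
  by rewrite iso /= ?in_itv/= ?ler0_norm; lra.
have d4 : mdist (c a) (c m) = m - a.
  by rewrite isom /= ?in_itv/= ?ler0_norm; lra.
have d5 : mdist (c a) (c (m - h)) = m - h - a.
  by rewrite isom /= ?in_itv/= ?ler0_norm; lra.
(* the CN step, the midpoint being identified by cm_unique *)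
have D : m + h - a <= mdist (c a) (c (m + h)).
  apply: le_of_sqr; first exact: mdist_ge0.
  have half : 0 <= (2^-1 : R) <= 1 by lra.
  have mid : mdist (c m) (G (c (m - h)) (c (m + h)) 2^-1) = 0.
    apply: (cm_unique GP) => //; rewrite ?d1 ?d3; first by lra.
    by rewrite metric_sym d2; lra.
  move/mdist_positivity : mid => mid.
  have := cm_cn GP (c (m - h)) (c (m + h)) (c a) half.
  by rewrite -mid d1 d4 d5; lra.
have lip s t : a <= s -> s <= t -> t <= m + h -> mdist (c s) (c t) <= t - s.
  move=> as' st th.
  have [tm|tm] := leP t m.
    by rewrite isom /= ?in_itv/= ?ler0_norm; lra.
  have [sm|sm] := leP (m - h) s.
    by rewrite iso /= ?in_itv/= ?ler0_norm; lra.
  apply: le_trans (metric_triangle _ (c m) _) _.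
  rewrite isom /= ?in_itv/= ?ler0_norm; try lra.
  by rewrite iso /= ?in_itv/= ?ler0_norm; lra.
have eqst s t : a <= s -> s <= t -> t <= m + h -> mdist (c s) (c t) = t - s.
  move=> as' st th; apply/eqP; rewrite eq_le lip//=.
  have := metric_triangle (c a) (c s) (c (m + h)).
  have := metric_triangle (c s) (c t) (c (m + h)).
  have l1 : mdist (c a) (c s) <= s - a by apply: lip => //; lra.
  have l2 : mdist (c t) (c (m + h)) <= m + h - t by apply: lip => //; lra.
  by lra.
move=> s t; rewrite /= !in_itv/= -/h => /andP[h1 h2] /andP[h3 h4].
clear -eqst h1 h2 h3 h4.
have [st|st] := leP s t; first by rewrite eqst// ler0_norm; lra.
by rewrite metric_sym eqst ?gtr0_norm; lra.
Qed.

Hypothesis complete : geodesically_complete X.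

Lemma geodesic_extends_to_ray p x : p != x ->
  exists c : R -> X, [/\ isometric_on `[0, +oo[ c, c 0 = p & c (mdist p x) = x].
Proof.
move=> px; have d0 : 0 < mdist p x by rewrite mdist_gt0.
have [geo _] := cat0; have [c [iso c0 c1]] := geo p x.
have [||c' loc c'E] := complete (I := `[0, mdist p x]) (c := c).
- by exists 0, (mdist p x); rewrite !in_itv/= !lexx ltW.
- exact: iso.
exists c'; split.
- move=> s t; rewrite /= !in_itv/= !andbT => s0 t0.
  have m0 : 0 <= Num.max s t by rewrite le_max s0.
  by apply: (local_geodesic_isometric loc m0);
    rewrite /= in_itv/= le_max lexx ?s0 ?t0 ?orbT.
- by rewrite c'E ?in_itv/= ?lexx ?ltW.
- by rewrite c'E ?in_itv/= ?lexx ?ltW.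
Qed.

End Cat0.

(** * Ultralimits and rays *)

Lemma mdist_lip2 (R : realType) (X : metricType R) (a b a' b' : X) :
  `|mdist a b - mdist a' b'| <= mdist a a' + mdist b b'.
Proof.
have := metric_triangle a a' b; have := metric_triangle a' b' b.
have := metric_triangle a' a b'; have := metric_triangle a b b'.
by rewrite (metric_sym b' b) (metric_sym a' a) ler_norml; lra.
Qed.

Section UltraLimit.
Context {R : realType} (X : metricType R).
Hypothesis proper : proper_space X.

Lemma mcball_compact (o : X) (r : R) : compact (mcball o r).
Proof.
apply: proper.
  move=> x clx; rewrite /mcball/=; apply/ler_addgt0Pr => e e0.
  have [|y [oy xy]] := clx (fun y => mdist x y < e).
    by apply/(@metricType_numDomainType.nbhs_mdistP R X x); exists e.
  by apply: le_trans (metric_triangle _ y _) _; rewrite (metric_sym y x) lerD// ltW.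
exists (r + r) => x y ox oy.
by apply: le_trans (metric_triangle _ o _) _; rewrite (metric_sym x o) lerD.
Qed.

(** One ultrafilter serves for all parameters s, which is why finitely many
    values z s can be approximated at the same index n. *)
Lemma ultralimit (y : R -> R -> X) (o : R -> X) (B : R -> R) :
  (forall s, exists T, forall n, T <= n -> mdist (o s) (y n s) <= B s) ->
  exists z : R -> X, forall (l : seq R) e N, 0 < e ->
    exists2 n, N <= n & forall s, s \in l -> mdist (z s) (y n s) < e.
Proof.
move=> bd.
have [U [UU sU]] := ultraFilterLemma (@proper_pinfty_nbhs R).
have UP : ProperFilter U := @ultra_proper _ _ UU.
have Uge N : U [set n | N <= n].
  by apply: sU; exists N; split; [exact: num_real|move=> n /ltW].
have lim s : exists z, forall e, 0 < e -> U [set n | mdist z (y n s) < e].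
  have FP : ProperFilter (y ^~ s @ U) by exact: fmap_proper_filter.
  have [|z [_ cl]] := @mcball_compact (o s) (B s) _ FP.
    by have [T hT] := bd s; apply: (@filterS _ U _ [set n | T <= n]) => //.
  exists z => e e0.
  have [//|Un] := in_ultra_setVsetC [set n | mdist z (y n s) < e] UU.
  have [||w [nw zw]] := cl [set w | ~ mdist z w < e] [set w | mdist z w < e].
  - exact: Un.
  - by apply/(@metricType_numDomainType.nbhs_mdistP R X z); exists e.
  by case: nw.
have [z zP] := choice lim; exists z => l e N e0.
suff : U [set n | N <= n /\ forall s, s \in l -> mdist (z s) (y n s) < e].
  by move/filter_ex => [n [Nn hn]]; exists n.
elim: l => [|s l IH].
  by apply: (@filterS _ U _ [set n | N <= n]) => // n Nn.
apply: filterS2 IH (zP s e e0) => n [Nn hl] hs; split=> // u.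
by rewrite inE => /orP[/eqP->//|]; exact: hl.
Qed.

End UltraLimit.

Section Rays.
Context {R : realType} (X : metricType R) (G : X -> X -> R -> X).
Hypothesis GP : convex_metric mdist G.
Implicit Types (p q x y : X) (s t u v : R).

(** All speeds are allowed, including 0, because the Euclidean cone over the
    boundary is made of the rays of all speeds. *)
Definition conical p v (c : R -> X) : Prop :=
  [/\ 0 <= v, c 0 = p &
      forall s t, 0 <= s -> 0 <= t -> mdist (c s) (c t) = v * `|s - t|].

Lemma conical_dist p v c s : conical p v c -> 0 <= s -> mdist p (c s) = v * s.
Proof. by move=> [_ <- h] s0; rewrite h// sub0r normrN ger0_norm. Qed.

Lemma conicalG p v c s t : conical p v c -> 0 <= s <= t -> 0 < t ->
  c s = G p (c t) (s / t).
Proof.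
move=> hc /andP[s0 st] t0; apply: mdist_positivity.
have [v0 c0 h] := hc.
apply: (cm_unique GP); first by rewrite divr_ge0 ?(ltW t0)//= ler_pdivrMr// mul1r.
- by rewrite !(conical_dist hc) ?(ltW t0)//; apply: le_of_eq; field; rewrite gt_eqF.
- rewrite h ?(ltW t0)// (conical_dist hc) ?(ltW t0)// ger0_norm ?subr_ge0//.
  by apply: le_of_eq; field; rewrite gt_eqF.
Qed.

(** So the quotient d(c t, c' t) / t is nondecreasing in t. *)
Lemma conical_mono p v v' c c' s t : conical p v c -> conical p v' c' ->
  0 <= s <= t -> 0 < t ->
  mdist (c s) (c' s) <= s / t * mdist (c t) (c' t).
Proof.
move=> hc hc' /[dup] st /andP[s0 st'] t0.
rewrite (conicalG hc st t0) (conicalG hc' st t0).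
by apply: (cm_shared GP); rewrite divr_ge0 ?(ltW t0)//= ler_pdivrMr// mul1r.
Qed.

Lemma conical_unique p v v' c c' K s : conical p v c -> conical p v' c' ->
  (forall t, 0 <= t -> mdist (c t) (c' t) <= K) -> 0 <= s -> c s = c' s.
Proof.
move=> hc hc' hK s0; apply: mdist_positivity; apply/eqP.
rewrite eq_le mdist_ge0 andbT; apply/ler_addgt0Pr => e e0; rewrite add0r.
have K0 : 0 <= K by apply: le_trans (hK 0 (lexx _)); exact: mdist_ge0.
pose t := s + 1 + s * K / e.
have sKe : 0 <= s * K / e by rewrite !mulr_ge0// invr_ge0 ltW.
have t0 : 0 < t by rewrite /t; lra.
have st : 0 <= s <= t by rewrite /t; lra.
apply: le_trans (conical_mono hc hc' st t0) _.
apply: le_trans (_ : s / t * K <= _).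
  by rewrite ler_wpM2l ?divr_ge0 ?(ltW t0)// hK// ltW.
rewrite mulrAC ler_pdivrMr// /t mulrDr mulrCA divff ?gt_eqF// mulr1 lerDr.
by rewrite mulr_ge0 ?(ltW e0)//; lra.
Qed.

Lemma ray_conical (c : ray X) : conical (c 0) 1 c.
Proof.
split=> // s t s0 t0; rewrite mul1r.
by apply: (ray_isometric c); rewrite /= in_itv/= andbT.
Qed.

Lemma conical_ray p c : conical p 1 c -> exists r : ray X, ray_fun r = c.
Proof.
move=> [_ _ h]; have iso : isometric_on `[0, +oo[ c.
  by move=> s t; rewrite /= !in_itv/= !andbT => s0 t0; rewrite h// mul1r.
by exists (Ray iso).
Qed.

Hypothesis proper : proper_space X.

(** The geodesics from q to points w n at distance O(n) accumulate on a ray of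
    constant speed.  This produces both the rays asymptotic to a given one and,
    in the Euclidean cone, the points between two rays. *)
Lemma limit_cone q (w : R -> X) V N0 : 0 <= V ->
  (forall n, N0 <= n -> mdist q (w n) <= V * n) ->
  exists v z, conical q v z /\
    forall (l : seq R) e N, 0 < e -> (forall s, s \in l -> 0 <= s) ->
      exists n, [/\ N <= n, 0 < n &
        forall s, s \in l -> s <= n /\ mdist (z s) (G q (w n) (s / n)) < e].
Proof.
move=> V0 hV.
have i01 s n : 0 <= s -> 0 < n -> s <= n -> 0 <= s / n <= 1.
  by move=> s0 n0 sn; rewrite divr_ge0 ?(ltW n0)//= ler_pdivrMr// mul1r.
(* negative parameters are sent to q to keep the family bounded *)
pose y n s := G q (w n) (Num.max 0 s / n).
have [|z zP] := ultralimit proper (y := y) (o := fun=> q)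
    (B := fun s => V * Num.max 0 s).
  move=> s; exists (Num.max (Num.max 0 s + 1) N0) => n.
  rewrite ge_max => /andP[sn Nn].
  have m0 : 0 <= Num.max 0 s by rewrite le_max lexx.
  have n0 : 0 < n by lra.
  apply: le_trans (cm_left GP _ _ (i01 _ _ m0 n0 _)) _; first lra.
  rewrite mulrAC ler_pdivrMr// mulrAC mulrC ler_wpM2r//.
  exact: hV.
have zl (l : seq R) e N : 0 < e -> (forall s, s \in l -> 0 <= s) ->
      exists n, [/\ N <= n, 0 < n &
        forall s, s \in l -> s <= n /\ mdist (z s) (G q (w n) (s / n)) < e].
  move=> e0 l0; pose M : R := \sum_(s <- l) s.
  have lM s : s \in l -> s <= M.
    rewrite /M; elim: l l0 {M} => // a l IH l0.
    have a0 : 0 <= a by apply: l0; rewrite mem_head.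
    have ll0 u : u \in l -> 0 <= u by move=> ul; apply: l0; rewrite inE ul orbT.
    have S0 : 0 <= \sum_(u <- l) u by rewrite big_seq sumr_ge0.
    rewrite big_cons inE => /orP[/eqP->|sl]; first lra.
    by have := IH ll0 sl; lra.
  have [n Nn nl] := zP l e (Num.max N (Num.max M 1)) e0.
  move: Nn; rewrite !ge_max => /andP[Nn /andP[Mn n1]].
  exists n; split=> //; first lra.
  move=> s sl; split; first exact: le_trans (lM _ sl) Mn.
  by have := nl s sl; rewrite /y max_r// l0.
exists (mdist q (z 1)), z; split=> //; split; first exact: mdist_ge0.
  apply: mdist_positivity; apply: (@eq_of_small _ _ _ 1) => // e e0.
  have [|n [_ n0 nl]] := zl [:: 0] e 0 e0; first by move=> s; rewrite inE => /eqP->.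
  have [_] := nl 0 (mem_head _ _); rewrite mul0r => h0.
  have := cm_left GP q (w n) itv01_0; rewrite mul0r => h1.
  have := metric_triangle (z 0) (G q (w n) 0) q.
  rewrite (metric_sym (G q (w n) 0) q) subr0 ger0_norm ?mdist_ge0//; lra.
move=> s t s0 t0; apply: (@eq_of_small _ _ _ (2 + `|s - t|)) => [|e e0].
  by rewrite addr_ge0.
have [|n [_ n0 nl]] := zl [:: s; t; 1] e 0 e0.
  by move=> u; rewrite !inE => /or3P[] /eqP->.
have [sn hs] := nl s (mem_head _ _).
have [|tn ht] := nl t _; first by rewrite !inE eqxx orbT.
have [|n1 h1] := nl 1 _; first by rewrite !inE eqxx !orbT.
have E : mdist (G q (w n) (s / n)) (G q (w n) (t / n)) = `|s - t| * (mdist q (w n) / n).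
  rewrite (cm_param_eq GP) ?i01// -mulrBl normrM (gtr0_norm (x := n^-1)) ?invr_gt0//.
  by rewrite mulrAC mulrA.
have E1 : mdist q (G q (w n) (1 / n)) = mdist q (w n) / n.
  have z01 := @itv01_0 R.
  by rewrite (cm_left_eq GP) ?i01// mul1r mulrC.
set D := mdist q (w n) / n in E E1.
have hv : `|mdist q (z 1) - D| <= e.
  have := mdist_lip2 q (z 1) q (G q (w n) (1 / n)).
  by rewrite E1 mdistxx add0r => /le_trans; apply; exact: ltW.
have hst : `|mdist (z s) (z t) - `|s - t| * D| <= 2 * e.
  have := mdist_lip2 (z s) (z t) (G q (w n) (s / n)) (G q (w n) (t / n)).
  by rewrite E => /le_trans; apply; lra.
have := ler_wpM2l (normr_ge0 (s - t)) hv.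
move: hst; set a := `|s - t|.
have a0 : 0 <= a by exact: normr_ge0.
have -> : a * `|mdist q (z 1) - D| = `|a * mdist q (z 1) - a * D|.
  by rewrite -mulrBr normrM (ger0_norm a0).
rewrite (mulrC _ a) !ler_norml; lra.
Qed.

(** The limit ray obtained from the points c n has speed 1 because
    d(q, c n) / n tends to 1, and it stays at bounded distance from c by
    convexity of the distance. *)
Lemma asymptotic_ray_exists q (c : ray X) :
  exists2 c' : ray X, c' 0 = q & asymptotic c c'.
Proof.
have hc := ray_conical c.
set D := mdist q (c 0); have D0 : 0 <= D by exact: mdist_ge0.
have qc n : 0 <= n -> n - D <= mdist q (c n) <= n + D.
  move=> n0; have := conical_dist hc n0; rewrite mul1r.
  have := metric_triangle q (c 0) (c n); have := metric_triangle (c 0) q (c n).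
  by rewrite (metric_sym _ q) -/D; lra.
have [||v [z [hz zP]]] := @limit_cone q c (1 + D) 1; first lra.
  move=> n n1; have /qc /andP[_] : 0 <= n by lra.
  by have := ler_wpM2l D0 n1; lra.
have v1 : v = 1.
  apply: (@eq_of_small _ _ _ 2) => // e e0.
  have [|n [Nn n0 nl]] := zP [:: 1] e (D / e) e0; first by move=> s; rewrite inE => /eqP->.
  have [n1 h] := nl 1 (mem_head _ _).
  have := mdist_lip2 q (z 1) q (G q (c n) (1 / n)).
  rewrite mdistxx add0r (conical_dist hz)// mulr1 (cm_left_eq GP); last first.
    by rewrite divr_ge0 ?(ltW n0)//= ler_pdivrMr// mul1r.
  have En : `|1 / n * mdist q (c n) - 1| <= e.
    have -> : 1 / n * mdist q (c n) - 1 = (mdist q (c n) - n) / n.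
      by field; rewrite gt_eqF.
    rewrite normrM (gtr0_norm (x := n^-1)) ?invr_gt0// ler_pdivrMr//.
    have /andP[h1 h2] := qc n (ltW n0).
    have Dn : D <= e * n by rewrite mulrC -ler_pdivrMr.
    by rewrite ler_norml; lra.
  by move: En; rewrite !ler_norml; lra.
have [c' c'E] : exists r : ray X, ray_fun r = z by apply: (@conical_ray q); rewrite -v1.
exists c'; first by rewrite c'E; case: hz.
exists (1 + D) => t t0; rewrite c'E.
have [|n [_ n0 nl]] := zP [:: t] 1 0 ltr01; first by move=> s; rewrite inE => /eqP->.
have [tn h] := nl t (mem_head _ _).
have t01 : 0 <= t / n <= 1 by rewrite divr_ge0 ?(ltW n0)//= ler_pdivrMr// mul1r.
apply: le_trans (metric_triangle _ (G q (c n) (t / n)) _) _.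
rewrite addrC (metric_sym _ (z t)); apply: lerD; first exact: ltW.
rewrite (conicalG hc (t := n)) ?t0//.
apply: le_trans (cm_convex GP _ _ _ _ t01) _.
rewrite mdistxx mulr0 addr0 (metric_sym _ q) -/D.
by have /andP[h1 _] := t01; have := mulr_ge0 h1 D0; lra.
Qed.

End Rays.

(** ** Ideal points seen from a base point *)

Section IdealBoundary.
Context {R : realType} (X : metricType R) (G : X -> X -> R -> X).
Hypothesis GP : convex_metric mdist G.
Hypothesis proper : proper_space X.
Implicit Types (p q x y : X) (s t u v : R) (xi eta : ideal_boundary X).
Local Open Scope quotient_scope.

Lemma pi_eq_asymptotic (c c' : ray X) :
  \pi_(ideal_boundary X) c = \pi_(ideal_boundary X) c' <-> asymptotic c c'.
Proof.
split; first by move/eqmodP => /asboolP.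
by move=> h; apply/eqmodP; apply/asboolP.
Qed.

Lemma ray_from_spec p xi :
  ray_from p xi 0 = p /\ \pi_(ideal_boundary X) (ray_from p xi) = xi.
Proof.
rewrite /ray_from; case: xgetP => [c _ //|none].
have [c' c'0 c'a] := asymptotic_ray_exists GP proper p (repr xi).
exfalso; apply: (none c'); split => //.
rewrite -[RHS]reprK; apply/pi_eq_asymptotic.
by have [K hK] := c'a; exists K => t t0; rewrite metric_sym hK.
Qed.

Lemma ray_from_conical p xi : conical p 1 (ray_from p xi).
Proof. by have [E _] := ray_from_spec p xi; rewrite -{1}E; exact: ray_conical. Qed.

Lemma ray_from_asymptotic p q xi : asymptotic (ray_from p xi) (ray_from q xi).
Proof.
apply/pi_eq_asymptotic.
by have [_ ->] := ray_from_spec p xi; have [_ ->] := ray_from_spec q xi.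
Qed.

Lemma conical_ray_from p c : conical p 1 c ->
  exists xi, forall s, 0 <= s -> ray_from p xi s = c s.
Proof.
move=> hc; have [r rE] := conical_ray hc.
exists (\pi_(ideal_boundary X) r) => s s0.
have [_] := ray_from_spec p (\pi_(ideal_boundary X) r).
move/pi_eq_asymptotic => [K hK].
apply: (conical_unique GP (ray_from_conical p _) hc _ s0) => t t0.
by rewrite -rE; exact: hK.
Qed.

Lemma ray_from_inj p xi eta :
  (forall s, 0 <= s -> ray_from p xi s = ray_from p eta s) -> xi = eta.
Proof.
move=> h; have [_ <-] := ray_from_spec p xi; have [_ <-] := ray_from_spec p eta.
by apply/pi_eq_asymptotic; exists 0 => t /h ->; rewrite mdistxx.
Qed.

End IdealBoundary.

(** * The Euclidean cone over the boundary *)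

Section EuclideanCone.
Context {R : realType} (X : metricType R) (G : X -> X -> R -> X).
Hypothesis GP : convex_metric mdist G.
Hypothesis proper : proper_space X.
Variable p : X.
Implicit Types (s t u v : R).

Record cone := Cone {
  cone_fun :> R -> X;
  cone_speed : R;
  coneP : conical p cone_speed cone_fun }.
Implicit Types a b c m : cone.

(** The quotients are nondecreasing in t, so this is their limit at infinity. *)
Definition cdist a b : R :=
  sup [set mdist (a t) (b t) / t | t in [set t : R | 0 < t]].

Lemma cone_dist a t : 0 <= t -> mdist p (a t) = cone_speed a * t.
Proof. exact: conical_dist (coneP a). Qed.

Lemma cone_speed_ge0 a : 0 <= cone_speed a.
Proof. by case: (coneP a). Qed.

Let ratios_sup a b : has_sup [set mdist (a t) (b t) / t | t in [set t : R | 0 < t]].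
Proof.
split; first by exists (mdist (a 1) (b 1) / 1); exists 1 => //=; exact: ltr01.
exists (cone_speed a + cone_speed b) => _ [t /= t0 <-].
have := metric_triangle (a t) p (b t).
by rewrite (metric_sym (a t) p) !cone_dist ?(ltW t0)// ler_pdivrMr// mulrDl.
Qed.

Lemma cdist_ub a b t : 0 <= t -> mdist (a t) (b t) <= cdist a b * t.
Proof.
rewrite le_eqVlt => /orP[/eqP<-|t0].
  have [_ -> _] := coneP a; have [_ -> _] := coneP b.
  by rewrite mdistxx mulr0.
rewrite -ler_pdivrMr//; apply: ub_le_sup; last by exists t.
by have [] := ratios_sup a b.
Qed.

Lemma cdist_le a b k : (forall t, 0 < t -> mdist (a t) (b t) <= k * t) ->
  cdist a b <= k.
Proof.
move=> h; apply: ge_sup; first by have [] := ratios_sup a b.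
by move=> _ [t /= t0 <-]; rewrite ler_pdivrMr// h.
Qed.

Lemma cdist_approx a b e : 0 < e -> exists2 T, 0 < T &
  forall t, T <= t -> (cdist a b - e) * t <= mdist (a t) (b t).
Proof.
move=> e0; have [_ [T /= T0 <-] h] := sup_adherent e0 (ratios_sup a b).
exists T => // t Tt; have t0 : 0 < t by exact: lt_le_trans Tt.
have Tt' : 0 <= T <= t by rewrite ltW.
have := conical_mono GP (coneP a) (coneP b) Tt' t0.
move=> h'; rewrite -ler_pdivlMr//; apply: le_trans (ltW h) _.
by rewrite ler_pdivrMr//; apply: le_trans h' _; apply: le_of_eq; ring.
Qed.

Lemma cdist_ge0 a b : 0 <= cdist a b.
Proof. by have := cdist_ub a b ler01; rewrite mulr1; apply: le_trans; exact: mdist_ge0. Qed.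

Lemma cdistxx a : cdist a a = 0.
Proof.
apply/eqP; rewrite eq_le cdist_ge0 andbT; apply: cdist_le => t _.
by rewrite mdistxx mul0r.
Qed.

Lemma cdist_sym a b : cdist a b = cdist b a.
Proof.
by apply/eqP; rewrite eq_le; apply/andP; split; apply: cdist_le => t t0;
  rewrite metric_sym cdist_ub// ltW.
Qed.

Lemma cdist_triangle b a c : cdist a c <= cdist a b + cdist b c.
Proof.
apply: cdist_le => t t0; apply: le_trans (metric_triangle _ (b t) _) _.
by rewrite mulrDl lerD// cdist_ub// ltW.
Qed.

Lemma cone_speed_lip a b : `|cone_speed a - cone_speed b| <= cdist a b.
Proof.
have := mdist_lip2 p (a 1) p (b 1); rewrite mdistxx add0r !cone_dist// !mulr1.
by move=> /le_trans; apply; have := cdist_ub a b ler01; rewrite mulr1.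
Qed.

(** Take the limit ray through the points at ratio s between a n and b n: the
    bounds hold at each n and pass to the limit by comparison from p. *)
Lemma cone_combination_exists a b s : 0 <= s <= 1 ->
  exists m, cdist a m <= s * cdist a b /\ cdist b m <= (1 - s) * cdist a b.
Proof.
move=> /[dup] s01 /andP[s0 s1].
pose w n := G (a n) (b n) s; pose V := cone_speed a + cone_speed b.
have a0 := cone_speed_ge0 a; have b0 := cone_speed_ge0 b.
have [||v [z [hz zP]]] := @limit_cone _ _ _ GP proper p w V 0.
- by rewrite addr_ge0.
- move=> n n0; apply: (cm_ball GP) => //; rewrite cone_dist// ler_wpM2r//;
    by rewrite /V; lra.
have key c k : (forall n, 0 < n -> mdist (c n) (w n) <= k * (cdist a b * n)) ->
    0 <= k -> cdist c (Cone hz) <= k * cdist a b.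
  move=> hk k0; apply: cdist_le => t t0 /=; apply: (@le_of_small _ _ _ 1) => // e e0.
  have [|n [_ n0 nl]] := zP [:: t] e 0 e0.
    by move=> u; rewrite inE => /eqP->; exact: ltW.
  have [tn h] := nl t (mem_head _ _).
  have t01 : 0 <= t / n <= 1 by rewrite divr_ge0 ?(ltW n0) ?(ltW t0)//= ler_pdivrMr// mul1r.
  apply: le_trans (metric_triangle _ (G p (w n) (t / n)) _) _.
  rewrite mul1r (metric_sym _ (z t)); apply: lerD; last exact: ltW.
  rewrite (conicalG GP (coneP c) (t := n)) ?tn ?(ltW t0)//.
  apply: le_trans (cm_shared GP _ _ _ t01) _.
  have /andP[q0 _] := t01.
  apply: le_trans (ler_wpM2l q0 (hk n n0)) _.
  by apply: le_of_eq; field; rewrite gt_eqF.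
have s1' : 0 <= 1 - s by lra.
exists (Cone hz); split; apply: key => // n n0.
- apply: le_trans (cm_left GP _ _ s01) _.
  by rewrite ler_wpM2l// cdist_ub// ltW.
- apply: le_trans (cm_right GP _ _ s01) _.
  by rewrite ler_wpM2l// cdist_ub// ltW.
Qed.

(** At a late time t, let w be the point at ratio s between a t and b t.  CN at
    w, applied to m t, gives d(m t, w)^2 <= s (1 - s) (t^2 D^2 - d(a t, b t)^2),
    which is o(t^2) as d(a t, b t) / t tends to D.  So m t may be replaced by w,
    for which CN in X is the inequality wanted, up to o(t^2). *)
Lemma cone_cn a b m z s : 0 <= s <= 1 ->
  cdist a m <= s * cdist a b -> cdist b m <= (1 - s) * cdist a b ->
  cdist z m ^+ 2 <= (1 - s) * cdist z a ^+ 2 + s * cdist z b ^+ 2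
                    - s * (1 - s) * cdist a b ^+ 2.
Proof.
move=> /[dup] s01 /andP[s0 s1] am bm.
set D := cdist a b in am bm *; set A := cdist z a; set B := cdist z b.
set M := cdist z m; set K := (X in _ <= X).
have D0 : 0 <= D := cdist_ge0 _ _; have M0 : 0 <= M := cdist_ge0 _ _.
have A0 : 0 <= A := cdist_ge0 _ _; have B0 : 0 <= B := cdist_ge0 _ _.
have s1' : 0 <= 1 - s by lra.
have DM : 0 <= D * M by exact: mulr_ge0.
apply: (@le_of_small _ _ _ (2 * D + 2 * M * (D + 2))); first lra.
(* f plays the part of a square root of the error: at time t the quotients are
   within f^2 of their limits, and then d(m t, w) is O(f t) *)
move=> e' e'0; pose f := Num.min e' 1.
have f0 : 0 < f by rewrite lt_min e'0 ltr01.
have f1 : f <= 1 by rewrite ge_min lexx orbT.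
have fe : f <= e' by rewrite ge_min lexx.
have e0 : 0 < f ^+ 2 by exact: exprn_gt0.
have [T1 T10 h1] := cdist_approx a b e0.
have [T2 T20 h2] := cdist_approx z m e0.
pose t := T1 + T2; have t0 : 0 < t by rewrite addr_gt0.
have {}h1 : (D - f ^+ 2) * t <= mdist (a t) (b t) by apply: h1; rewrite /t; lra.
have {}h2 : (M - f ^+ 2) * t <= mdist (z t) (m t) by apply: h2; rewrite /t; lra.
pose w := G (a t) (b t) s.
have ratio (x y : X) : exists2 k, 0 <= k & mdist x y = k * t.
  exists (mdist x y / t); first by rewrite divr_ge0 ?mdist_ge0 ?ltW.
  by rewrite divfK// gt_eqF.
have [al al0 alE] := ratio (a t) (b t).
have [mu mu0 muE] := ratio (m t) w.
have [om om0 omE] := ratio (z t) w.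
have t2 : 0 < t ^+ 2 by exact: exprn_gt0.
have alD : al <= D by rewrite -(ler_pM2r t0) -alE cdist_ub// ltW.
have {}h1 : D - f ^+ 2 <= al by rewrite -(ler_pM2r t0) -alE.
have al2 : D ^+ 2 - al ^+ 2 <= 2 * D * f ^+ 2.
  have e1 : D - al <= f ^+ 2 by lra.
  have e2 : D + al <= 2 * D by lra.
  have e3 : 0 <= D + al by lra.
  have e4 : 0 <= f ^+ 2 by exact: ltW.
  have -> : D ^+ 2 - al ^+ 2 = (D + al) * (D - al) by ring.
  apply: le_trans (ler_wpM2l e3 e1) _; exact: ler_wpM2r.
have al2' : 0 <= D ^+ 2 - al ^+ 2.
  by rewrite subr_ge0 ler_pXn2r ?nnegrE.
have sqle (x y : X) k : 0 <= k -> mdist x y <= k * t -> mdist x y ^+ 2 <= k ^+ 2 * t ^+ 2.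
  by move=> k0 h; rewrite -exprMn ler_pXn2r ?nnegrE ?mdist_ge0// mulr_ge0// ltW.
have ss1 : s * (1 - s) <= 1 by have := mulr_ge0 s0 s0; lra.
have ss0 : 0 <= s * (1 - s) by exact: mulr_ge0.
have mu2 : mu ^+ 2 <= 2 * D * f ^+ 2.
  suff : mu ^+ 2 <= s * (1 - s) * (D ^+ 2 - al ^+ 2).
    by have := ler_wpM2r al2' ss1; lra.
  rewrite -(ler_pM2r t2).
  have := cm_cn GP (a t) (b t) (m t) s01; rewrite -/w muE alE exprMn => /le_trans; apply.
  have k1 : mdist (m t) (a t) ^+ 2 <= (s * D) ^+ 2 * t ^+ 2.
    apply: sqle; first exact: mulr_ge0.
    by rewrite metric_sym; apply: le_trans (cdist_ub _ _ (ltW t0)) _; rewrite ler_wpM2r ?(ltW t0).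
  have k2 : mdist (m t) (b t) ^+ 2 <= ((1 - s) * D) ^+ 2 * t ^+ 2.
    apply: sqle; first exact: mulr_ge0.
    by rewrite metric_sym; apply: le_trans (cdist_ub _ _ (ltW t0)) _; rewrite ler_wpM2r ?(ltW t0).
  by have := ler_wpM2l s1' k1; have := ler_wpM2l s0 k2; rewrite exprMn; lra.
have om2 : om ^+ 2 <= K + 2 * D * f ^+ 2.
  suff : om ^+ 2 <= K + s * (1 - s) * (D ^+ 2 - al ^+ 2).
    by have := ler_wpM2r al2' ss1; lra.
  rewrite -(ler_pM2r t2).
  have := cm_cn GP (a t) (b t) (z t) s01; rewrite -/w omE alE exprMn => /le_trans; apply.
  have k1 : mdist (z t) (a t) ^+ 2 <= A ^+ 2 * t ^+ 2.
    by apply: sqle => //; rewrite cdist_ub// ltW.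
  have k2 : mdist (z t) (b t) ^+ 2 <= B ^+ 2 * t ^+ 2.
    by apply: sqle => //; rewrite cdist_ub// ltW.
  by have := ler_wpM2l s1' k1; have := ler_wpM2l s0 k2; rewrite /K exprMn; lra.
have muf : mu <= (D + 1) * f.
  apply: le_of_sqr; first by rewrite mulr_ge0 ?(ltW f0)//; lra.
  apply: le_trans mu2 _; rewrite exprMn ler_wpM2r ?(ltW e0)//.
  by have := sqr_ge0 D; lra.
have Mom : M - f ^+ 2 - mu <= om.
  rewrite -(ler_pM2r t0) mulrBl lerBlDr -omE -muE.
  apply: le_trans h2 _; apply: le_trans (metric_triangle _ w _) _.
  by rewrite (metric_sym w).
have ff : f ^+ 2 <= f by rewrite expr2 -[leRHS]mulr1 ler_wpM2l// ltW.
(* if M is smaller than the error, the bound holds because om^2 >= 0 *)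
have fin : M ^+ 2 <= K + 2 * D * f ^+ 2 + 2 * M * (f ^+ 2 + mu).
  have fm : 0 <= f ^+ 2 + mu by rewrite addr_ge0// ltW.
  have [neg|pos] := ltP (M - f ^+ 2 - mu) 0.
    have lM : M <= f ^+ 2 + mu by lra.
    have := ler_wpM2l M0 lM; have := sqr_ge0 om; have := mulr_ge0 M0 fm; lra.
  have : (M - f ^+ 2 - mu) ^+ 2 <= om ^+ 2 by rewrite ler_pXn2r ?nnegrE.
  by have := sqr_ge0 (f ^+ 2 + mu); lra.
have c1 : 2 * D * f ^+ 2 <= 2 * D * f by rewrite ler_wpM2l//; lra.
have c2 : M * (f ^+ 2 + mu) <= M * ((D + 2) * f) by rewrite ler_wpM2l//; lra.
have c3 : (2 * D + 2 * M * (D + 2)) * f <= (2 * D + 2 * M * (D + 2)) * e'.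
  by rewrite ler_wpM2l//; lra.
by lra.
Qed.

Lemma cone_convex : exists CG, convex_metric cdist CG.
Proof.
pose P (abs : cone * cone * R) m := 0 <= abs.2 <= 1 ->
  cdist abs.1.1 m <= abs.2 * cdist abs.1.1 abs.1.2 /\
  cdist abs.1.2 m <= (1 - abs.2) * cdist abs.1.1 abs.1.2.
have [|f fP] := choice (_ : forall abs, exists m, P abs m).
  move=> [[a b] s]; have [s01|ns] := pselect (0 <= s <= 1).
    by have [m hm] := cone_combination_exists a b s01; exists m.
  by exists a.
exists (fun a b s => f (a, b, s)); split.
- exact: cdistxx.
- exact: cdist_sym.
- exact: cdist_triangle.
- move=> a b z s s01; have [h1 h2] := fP (a, b, s) s01.
  exact: cone_cn.
Qed.

End EuclideanCone.

(** * Angles and chords *)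

Section Trigo.
Context {R : realType}.
Implicit Types x y : R.

Lemma acos_le x y : -1 <= x -> x <= y -> y <= 1 -> acos y <= acos x.
Proof.
move=> x1 xy y1; rewrite leNgt; apply/negP => h.
have ix : -1 <= x <= 1 by rewrite x1 (le_trans xy).
have iy : -1 <= y <= 1 by rewrite y1 (le_trans x1).
have : cos (acos y) < cos (acos x).
  by rewrite ltr_cos// in_itv/= acos_ge0 ?acos_lepi.
by rewrite !acosK ?in_itv//= ltNge xy.
Qed.

(** The constant is not sharp, but any positive one will do.  On [0, 1] the slope
    of sin is at least cos 1; beyond 1, sin still increases and x stays below 2. *)
Lemma sin_ge_linear x : 0 <= x <= pi / 2 -> cos 1 / 2 * x <= sin x.
Proof.
move=> /andP[x0 xpi]; have c1 := @cos1_gt0 R.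
have [x1|x1] := leP x 1.
  have cs : {within `[0, x], continuous (@sin R)}.
    exact: continuous_subspaceT (@continuous_sin R).
  have [c /itvP cx E] := MVT_segment x0 (fun y _ => is_derive_sin y) cs.
  have -> : sin x = cos c * x by rewrite -[LHS]subr0 -sin0 E subr0.
  rewrite ler_wpM2r//; apply: (@le_trans _ _ (cos 1)); first lra.
  have := @pi_ge2 R.
  have [c1'|c1'] := ltP c 1; last by have -> : c = 1 by apply/eqP; rewrite eq_le c1' (le_trans _ x1)// cx.
  by move=> p2; apply: ltW; rewrite ltr_cos// in_itv/= ?ler01 ?cx//; lra.
have p2 := @pihalf_lt2 R; have p1 := @pihalf_ge1 R.
apply: (@le_trans _ _ (sin 1)).
  have cs : {within `[0, 1], continuous (@sin R)}.
    exact: continuous_subspaceT (@continuous_sin R).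
  have [c /itvP cx E] := MVT_segment ler01 (fun y _ => is_derive_sin y) cs.
  have -> : sin 1 = cos c * 1 :> R by rewrite -[LHS]subr0 -sin0 E subr0.
  have h1 : cos 1 / 2 * x <= cos 1 by rewrite -mulrA -[leRHS]mulr1 ler_pM2l//; lra.
  apply: le_trans h1 _; rewrite mulr1.
  have [c1'|c1'] := ltP c 1; last by have -> : c = 1 by apply/eqP; rewrite eq_le c1' cx.
  by apply: ltW; rewrite ltr_cos// in_itv/= ?ler01 ?cx//; have := @pi_ge2 R; lra.
apply: ltW; rewrite ltr_sin// in_itv/=; lra.
Qed.

(** The left-hand side is the angle subtended by a chord of length x of the unit
    circle. *)
Lemma acos_chord x : 0 <= x <= 2 -> acos (1 - x ^+ 2 / 2) <= 2 / cos 1 * x.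
Proof.
move=> /andP[x0 x2]; have c1 := @cos1_gt0 R.
have x4 : x ^+ 2 <= 2 ^+ 2 by rewrite ler_pXn2r ?nnegrE.
have i : -1 <= 1 - x ^+ 2 / 2 <= 1 by have := sqr_ge0 x; lra.
set th := acos _.
have th0 : 0 <= th by exact: acos_ge0.
have thpi : th <= pi by exact: acos_lepi.
have E : cos th = 1 - x ^+ 2 / 2 by rewrite acosK// in_itv.
have p0 := @pi_ge2 R.
have s0 : 0 <= sin (th / 2) by apply: sin_ge0_pi; lra.
have s2 : sin (th / 2) ^+ 2 = (x / 2) ^+ 2.
  have th2 : (th / 2) *+ 2 = th by rewrite mulr2n -splitr.
  have h1 := cos_mulr2n (th / 2); have h2 := cos2sin2 (th / 2).
  rewrite th2 E in h1; lra.
have {}s2 : sin (th / 2) = x / 2.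
  apply/eqP; rewrite eq_le; apply/andP; split; apply: le_of_sqr => //; rewrite ?s2//.
  by rewrite divr_ge0.
have h : cos 1 / 2 * (th / 2) <= x / 2.
  by rewrite -s2; apply: sin_ge_linear; lra.
rewrite mulrAC ler_pdivlMr//; lra.
Qed.

Lemma one_minus_cos_small k : 0 < k :> R ->
  exists2 phi, 0 < phi <= pi & 2 * (1 - cos phi) <= k.
Proof.
move=> k0; have := @continuous_cos R 0; rewrite /continuous_at cos0.
move=> /cvgrPdist_lt /(_ (k / 2)) []; first lra.
move=> r /= r0 h; exists (Num.min (r / 2) pi).
  by rewrite lt_min pi_gt0 andbT ge_min lexx orbT andbT; lra.
set y := Num.min _ _.
have yr : y <= r / 2 by rewrite ge_min lexx.
have y0 : 0 <= y by rewrite le_min pi_ge0 andbT; lra.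
have /h : `|0 - y| < r by rewrite sub0r normrN ger0_norm//; lra.
by rewrite ltr_norml; lra.
Qed.

End Trigo.

(** * The chord metric on the ideal boundary *)

Section ChordMetric.
Context {R : realType} (X : metricType R) (G : X -> X -> R -> X).
Hypothesis GP : convex_metric mdist G.
Hypothesis proper : proper_space X.
Variable p : X.
Implicit Types (xi eta zeta : ideal_boundary X) (s t u v : R).

Definition ray_cone xi : cone p := Cone (ray_from_conical GP proper p xi).

Definition chord xi eta : R := cdist (ray_cone xi) (ray_cone eta).

Lemma chord_ge0 xi eta : 0 <= chord xi eta. Proof. exact: cdist_ge0. Qed.

Lemma chord_sym xi eta : chord xi eta = chord eta xi. Proof. exact: cdist_sym. Qed.

Lemma chordxx xi : chord xi xi = 0. Proof. exact: cdistxx. Qed.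

Lemma chord_triangle zeta xi eta : chord xi eta <= chord xi zeta + chord zeta eta.
Proof. exact: cdist_triangle. Qed.

Lemma chord_le2 xi eta : chord xi eta <= 2.
Proof.
apply: cdist_le => t t0; apply: le_trans (metric_triangle _ p _) _.
rewrite metric_sym (cone_dist (ray_cone xi) (ltW t0)).
by rewrite (cone_dist (ray_cone eta) (ltW t0))/=; lra.
Qed.

Lemma chord0_eq xi eta : chord xi eta = 0 -> xi = eta.
Proof.
move=> h; apply: (ray_from_inj GP proper (p := p)) => s s0; apply: mdist_positivity.
apply/eqP; rewrite eq_le mdist_ge0 andbT.
by have := cdist_ub (ray_cone xi) (ray_cone eta) s0; rewrite -/(chord _ _) h mul0r.
Qed.

Definition direction (m : cone p) xi : Prop :=
  forall s, 0 <= s -> ray_from p xi s = m (s / cone_speed m).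

Lemma direction_exists (m : cone p) : 0 < cone_speed m ->
  exists xi, direction m xi.
Proof.
move=> v0; apply: (conical_ray_from GP proper (c := fun s => m (s / cone_speed m))).
have [_ m0 h] := coneP m; split=> //; first by rewrite mul0r.
move=> s t s0 t0; rewrite h ?divr_ge0 ?(ltW v0)// -mulrBl normrM.
by rewrite (gtr0_norm (x := _^-1)) ?invr_gt0// mul1r; field; rewrite gt_eqF.
Qed.

(** Radial projection of the Euclidean cone to its unit sphere is Lipschitz away
    from the apex. *)
Lemma direction_lip (m m' : cone p) xi xi' :
  0 < cone_speed m -> 0 < cone_speed m' -> direction m xi -> direction m' xi' ->
  cone_speed m * chord xi xi' <= 2 * cdist m m'.
Proof.
move=> v0 v0' mxi mxi'; rewrite mulrC -ler_pdivlMr//.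
apply: cdist_le => t t0 /=; rewrite mxi ?mxi' ?(ltW t0)//.
set v := cone_speed m in v0 *; set v' := cone_speed m' in v0' *.
apply: le_trans (metric_triangle _ (m' (t / v)) _) _.
have tv : 0 <= t / v by rewrite divr_ge0// ltW.
have h1 := cdist_ub m m' tv.
have h2 : mdist (m' (t / v)) (m' (t / v')) <= cdist m m' * (t / v).
  have [_ _ ->//] := coneP m'; last by rewrite divr_ge0// ltW.
  have -> : cone_speed m' * `|t / v - t / v'| = `|v' - v| * (t / v).
    have -> : t / v - t / v' = (v' - v) * (t / v) / v'.
      by field; rewrite !gt_eqF.
    rewrite normrM normrM (ger0_norm tv) (gtr0_norm (x := _^-1)) ?invr_gt0// -/v'.
    by field; rewrite !gt_eqF.
  rewrite ler_wpM2r// distrC; exact: cone_speed_lip.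
by apply: le_trans (lerD h1 h2) _; apply: le_of_eq; field; rewrite gt_eqF.
Qed.

Lemma direction_ray_cone xi : direction (ray_cone xi) xi.
Proof. by move=> s s0 /=; rewrite divr1. Qed.

(** The limit of the quotients does not depend on the base point, since asymptotic
    rays stay at bounded distance, and for rays from q they increase to it. *)
Lemma ray_dist_le q xi eta t : 0 <= t ->
  mdist (ray_from q xi t) (ray_from q eta t) <= chord xi eta * t.
Proof.
rewrite le_eqVlt => /orP[/eqP<-|t0].
  by have [_ -> _] := ray_from_conical GP proper q xi;
     have [_ -> _] := ray_from_conical GP proper q eta; rewrite mdistxx mulr0.
have [K hK] := ray_from_asymptotic GP proper q p xi.
have [L hL] := ray_from_asymptotic GP proper p q eta.
have K0 : 0 <= K by apply: le_trans (hK 0 (lexx _)); exact: mdist_ge0.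
have L0 : 0 <= L by apply: le_trans (hL 0 (lexx _)); exact: mdist_ge0.
apply: (@le_of_small _ _ _ (K + L)); first lra.
move=> e e0; pose T := t + t / e.
have te : 0 < t / e by rewrite divr_gt0.
have T0 : 0 < T by rewrite addr_gt0.
have tT : 0 <= t <= T by rewrite (ltW t0) lerDl ltW.
apply: le_trans (conical_mono GP (ray_from_conical GP proper q xi)
  (ray_from_conical GP proper q eta) tT T0) _.
have tT0 : 0 <= t / T by rewrite divr_ge0// ltW.
have tTe : t / T <= e.
  rewrite ler_pdivrMr// /T mulrDr [e * (t / e)]mulrC divfK ?gt_eqF//.
  by rewrite lerDr mulr_ge0// ltW.
have h : mdist (ray_from q xi T) (ray_from q eta T) <= chord xi eta * T + (K + L).
  have h1 := cdist_ub (ray_cone xi) (ray_cone eta) (ltW T0).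
  have h2 := hK T (ltW T0); have h3 := hL T (ltW T0).
  have h4 := metric_triangle (ray_from q xi T) (ray_from p xi T) (ray_from q eta T).
  have h5 := metric_triangle (ray_from p xi T) (ray_from p eta T) (ray_from q eta T).
  by move: h1; rewrite -/(chord _ _) /=; lra.
apply: le_trans (ler_wpM2l tT0 h) _.
have KL : 0 <= K + L by lra.
have := ler_wpM2r KL tTe.
have -> : t / T * (chord xi eta * T + (K + L)) = chord xi eta * t + t / T * (K + L).
  by field; rewrite gt_eqF.
lra.
Qed.

(** Two rays from q are at most as far apart as two Euclidean rays whose points
    at distance 1 from the apex have distance chord xi eta. *)
Lemma comparison_angle_bounds q xi eta s t : 0 < s -> 0 < t ->
  let z := (s ^+ 2 + t ^+ 2 - mdist (ray_from q xi s) (ray_from q eta t) ^+ 2)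
           / (2 * s * t) in
  1 - chord xi eta ^+ 2 / 2 <= z <= 1 /\
  comparison_angle q (ray_from q xi s) (ray_from q eta t) = acos z.
Proof.
move=> s0 t0 z.
have hx := ray_from_conical GP proper q xi.
have hy := ray_from_conical GP proper q eta.
split; last first.
  by rewrite /comparison_angle (conical_dist hx (ltW s0)) (conical_dist hy (ltW t0)) !mul1r.
rewrite {}/z; set D := mdist _ _; set c := chord xi eta.
have st0 : 0 < 2 * s * t by rewrite !mulr_gt0.
pose T := s + t; have T0 : 0 < T by rewrite addr_gt0.
have sT : 0 <= s <= T by rewrite /T; lra.
have tT : 0 <= t <= T by rewrite /T; lra.
have i u : 0 <= u <= T -> 0 <= u / T <= 1.
  by move=> /andP[u0 uT]; rewrite divr_ge0 ?(ltW T0)//= ler_pdivrMr// mul1r.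
have := cm_triangle_sqr GP q (ray_from q xi T) (ray_from q eta T) (i _ sT) (i _ tT).
rewrite -(conicalG GP hx sT T0) -(conicalG GP hy tT T0) -/D.
rewrite (conical_dist hx (ltW T0)) (conical_dist hy (ltW T0)) !mul1r => h.
have hT := ray_dist_le q xi eta (ltW T0); rewrite -/c in hT.
have hT2 : mdist (ray_from q xi T) (ray_from q eta T) ^+ 2 <= c ^+ 2 * T ^+ 2.
  by rewrite -exprMn ler_pXn2r ?nnegrE ?mdist_ge0 ?mulr_ge0 ?chord_ge0 ?(ltW T0).
have stT : 0 <= s / T * (t / T) by rewrite mulr_ge0// divr_ge0 ?(ltW T0)// ltW.
have D2 : D ^+ 2 <= s ^+ 2 + t ^+ 2 - 2 * s * t + s * t * c ^+ 2.
  apply: le_trans h _; have := ler_wpM2l stT hT2.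
  have -> : s / T * (t / T) * (c ^+ 2 * T ^+ 2) = s * t * c ^+ 2.
    by field; rewrite gt_eqF.
  have -> : T ^+ 2 * ((s / T) ^+ 2 - s / T * (t / T)) = s ^+ 2 - s * t.
    by field; rewrite gt_eqF.
  have -> : T ^+ 2 * ((t / T) ^+ 2 - s / T * (t / T)) = t ^+ 2 - s * t.
    by field; rewrite gt_eqF.
  lra.
apply/andP; split; first by rewrite ler_pdivlMr//; lra.
rewrite ler_pdivrMr// mul1r.
have : `|s - t| ^+ 2 <= D ^+ 2.
  rewrite ler_pXn2r ?nnegrE ?mdist_ge0//.
  have := mdist_lip2 q (ray_from q xi s) q (ray_from q eta t).
  by rewrite mdistxx add0r (conical_dist hx (ltW s0)) (conical_dist hy (ltW t0)) !mul1r.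
by rewrite -normrX ger0_norm ?sqr_ge0//; lra.
Qed.

Let chord_itv xi eta : -1 <= 1 - chord xi eta ^+ 2 / 2 <= 1.
Proof.
have : chord xi eta ^+ 2 <= 2 ^+ 2 by rewrite ler_pXn2r ?nnegrE ?chord_ge0 ?chord_le2.
by have := sqr_ge0 (chord xi eta); lra.
Qed.

Lemma comparison_angle_itv q xi eta s t : 0 < s -> 0 < t ->
  0 <= comparison_angle q (ray_from q xi s) (ray_from q eta t) <=
    acos (1 - chord xi eta ^+ 2 / 2).
Proof.
move=> s0 t0; have [/andP[z1 z2] ->] := comparison_angle_bounds q xi eta s0 t0.
have /andP[c1 c2] := chord_itv xi eta.
by rewrite acos_ge0 ?acos_le// (le_trans c1) ?z2.
Qed.

(** The suprema whose infimum over e is the Alexandrov angle. *)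
Definition angle_sup q xi eta e : R :=
  sup [set b | exists s t : R, [/\ 0 < s < e, 0 < t < e
    & b = comparison_angle q (ray_from q xi s) (ray_from q eta t)]].

Lemma angle_supP q xi eta e : 0 < e ->
  0 <= angle_sup q xi eta e <= acos (1 - chord xi eta ^+ 2 / 2) /\
  forall s, 0 < s < e ->
    comparison_angle q (ray_from q xi s) (ray_from q eta s) <= angle_sup q xi eta e.
Proof.
move=> e0; set A := acos _.
have ub : has_ubound [set b | exists s t : R, [/\ 0 < s < e, 0 < t < e
    & b = comparison_angle q (ray_from q xi s) (ray_from q eta t)]].
  exists A => _ [s [t [/andP[s0 _] /andP[t0 _] ->]]].
  by have /andP[] := comparison_angle_itv q xi eta s0 t0.
have le s : 0 < s < e ->
    comparison_angle q (ray_from q xi s) (ray_from q eta s) <= angle_sup q xi eta e.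
  by move=> se; apply: ub_le_sup => //; exists s, s.
have e2 : 0 < e / 2 < e by lra.
have /andP[e20 _] := e2.
split=> //; apply/andP; split.
  apply: le_trans (le _ e2).
  by have /andP[] := comparison_angle_itv q xi eta e20 e20.
apply: ge_sup; first by eexists; exists (e / 2), (e / 2); split.
move=> _ [s [t [/andP[s0 _] /andP[t0 _] ->]]].
by have /andP[] := comparison_angle_itv q xi eta s0 t0.
Qed.

Lemma angle_at_le q xi eta : angle_at q xi eta <= acos (1 - chord xi eta ^+ 2 / 2).
Proof.
apply: le_trans (_ : angle_sup q xi eta 1 <= _); last first.
  by have [/andP[]] := angle_supP q xi eta ltr01.
apply: inf_lbound; last by exists 1.
exists 0 => _ [e e0 ->].
by have [/andP[]] := angle_supP q xi eta e0.
Qed.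

Lemma angle_at_lt q xi eta phi : angle_at q xi eta < phi ->
  exists2 e, 0 < e & forall s, 0 < s < e ->
    comparison_angle q (ray_from q xi s) (ray_from q eta s) < phi.
Proof.
move=> h; apply: contrapT => none.
suff : phi <= angle_at q xi eta by rewrite leNgt h.
apply: lb_le_inf; first by eexists; exists 1.
move=> _ [e e0 ->]; rewrite leNgt; apply/negP => hlt; apply: none.
exists e => // s se; apply: le_lt_trans hlt.
by have [_] := angle_supP q xi eta e0; exact.
Qed.

Lemma angle_metric_le xi eta :
  angle_metric xi eta <= acos (1 - chord xi eta ^+ 2 / 2).
Proof.
apply: ge_sup; first by exists (angle_at p xi eta), p.
by move=> _ [q _ <-]; exact: angle_at_le.
Qed.

Lemma angle_metric_chord xi eta : angle_metric xi eta <= 2 / cos 1 * chord xi eta.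
Proof.
apply: le_trans (angle_metric_le _ _) _; apply: acos_chord.
by rewrite chord_ge0 chord_le2.
Qed.

Lemma angle_at_le_metric q xi eta : angle_at q xi eta <= angle_metric xi eta.
Proof.
apply: ub_le_sup; last by exists q.
by exists (acos (1 - chord xi eta ^+ 2 / 2)) => _ [q' _ <-]; exact: angle_at_le.
Qed.

End ChordMetric.

(** * The chord metric induces the Tits topology *)

Section TitsTopology.
Context {R : realType} (X : metricType R) (G : X -> X -> R -> X).
Hypothesis GP : convex_metric mdist G.
Hypothesis proper : proper_space X.
Variable p : X.
Implicit Types (xi eta zeta : ideal_boundary X) (s t u v : R).
Notation chord := (@chord R X G GP proper p).
Notation ray_cone := (@ray_cone R X G GP proper p).

Lemma ray_from_shift xi t s : 0 <= t -> 0 <= s ->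
  ray_from (ray_from p xi t) xi s = ray_from p xi (t + s).
Proof.
move=> t0 s0; set q := ray_from p xi t.
have hp := ray_from_conical GP proper p xi; have [_ _ iso] := hp.
have hq := ray_from_conical GP proper q xi.
have hs : conical q 1 (fun s => ray_from p xi (t + s)).
  split=> //; first by rewrite addr0.
  move=> a b a0 b0; rewrite iso ?addr_ge0//; congr (_ * `| _ |); ring.
have [K hK] := ray_from_asymptotic GP proper q p xi.
apply: (conical_unique GP hq hs _ s0 (K := K + t)) => a a0.
apply: le_trans (metric_triangle _ (ray_from p xi a) _) _.
apply: lerD; first exact: hK.
rewrite iso ?addr_ge0// mul1r opprD addrCA subrr addr0 normrN ger0_norm//.
Qed.

(** Suppose that at q = xi(t) the rays to xi and to eta form a small angle.  Then
    the ray from q to eta leaves q almost opposite to p, so by comparison at q it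
    stays almost at distance t + u from p: L = d(p, z) satisfies
    L^2 >= (t + u)^2 - 4 k t u, where z is its point at time u and k = e^2 / 4.
    CN on the segment from p to z then puts q close to its point h at ratio
    t / u; as u tends to infinity, h converges to eta(t). *)
Lemma chord_of_rays_close (xi eta : ideal_boundary X) e : 0 < e <= 1 ->
  (forall q, exists2 r, 0 < r & forall s, 0 < s < r ->
     mdist (ray_from q xi s) (ray_from q eta s) <= e ^+ 2 / 4 * s) ->
  chord xi eta <= e.
Proof.
move=> /andP[e0 e1] close; set k := e ^+ 2 / 4.
have k0 : 0 <= k by rewrite /k divr_ge0 ?sqr_ge0.
have k1 : k <= 1.
  have : e ^+ 2 <= 1 by rewrite expr_le1// ltW.
  by rewrite /k; lra.
apply: cdist_le => t t0 /=.
set q := ray_from p xi t.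
have hxi := ray_from_conical GP proper p xi; have [_ _ isoxi] := hxi.
have heta := ray_from_conical GP proper p eta.
have hz := ray_from_conical GP proper q eta.
have [K hK] := ray_from_asymptotic GP proper q p eta.
have K0 : 0 <= K by apply: le_trans (hK 0 (lexx _)); exact: mdist_ge0.
have pq : mdist p q = t by rewrite (conical_dist hxi (ltW t0)) mul1r.
have [r r0 hr] := close q.
pose s := Num.min (r / 2) t.
have s0 : 0 < s by rewrite lt_min t0 andbT; lra.
have sr : s < r by apply: le_lt_trans (_ : _ <= r / 2) _; [rewrite ge_min lexx|lra].
have st : s <= t by rewrite ge_min lexx orbT.
have close_s : mdist (ray_from p xi (t + s)) (ray_from q eta s) <= k * s.
  by rewrite -(ray_from_shift xi (ltW t0) (ltW s0)); apply: hr; rewrite s0 sr.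
apply: (@le_of_small _ _ _ (t + K)) => [|e' e'0]; first lra.
(* with this choice t / u <= e' *)
pose u := t + t / e'.
have te' : 0 < t / e' by rewrite divr_gt0.
have u0 : 0 < u by rewrite addr_gt0.
have tu : t <= u by rewrite /u lerDl ltW.
have su : s <= u by exact: le_trans tu.
have tue : t / u <= e'.
  rewrite ler_pdivrMr// /u mulrDr [e' * (t / e')]mulrC divfK ?gt_eqF//.
  by rewrite lerDr mulr_ge0// ltW.
have tu0 : 0 <= t / u by rewrite divr_ge0// ltW.
have tu1 : t / u <= 1 by rewrite ler_pdivrMr// mul1r.
have tu01 : 0 <= t / u <= 1 by rewrite tu0.
have su01 : 0 <= s / u <= 1 by rewrite divr_ge0 ?(ltW s0) ?(ltW u0)//= ler_pdivrMr// mul1r.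
have st01 : 0 <= s / t <= 1 by rewrite divr_ge0 ?(ltW s0) ?(ltW t0)//= ler_pdivrMr// mul1r.
set z := ray_from q eta u; set L := mdist p z.
have qz : mdist q z = u by rewrite (conical_dist hz (ltW u0)) mul1r.
have ts0 : 0 <= t - s by lra.
have back : ray_from p xi (t - s) = G q p (s / t).
  apply: mdist_positivity; apply: (cm_unique GP st01).
  - rewrite (metric_sym q p) pq /q isoxi ?(ltW t0)// mul1r divfK ?gt_eqF//.
    by rewrite opprD opprK addrA subrr add0r ger0_norm// ltW.
  - rewrite (conical_dist hxi ts0) mul1r (metric_sym q p) pq.
    by apply: le_of_eq; field; rewrite gt_eqF.
have zs : ray_from q eta s = G q z (s / u) by apply: (conicalG GP hz (t := u)); rewrite ?(ltW s0).
have apart : s * (2 - k) <= mdist (G q p (s / t)) (G q z (s / u)).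
  rewrite -back -zs.
  have := metric_triangle (ray_from p xi (t - s)) (ray_from q eta s) (ray_from p xi (t + s)).
  have ts : 0 <= t + s by rewrite addr_ge0 ?ltW.
  rewrite isoxi // mul1r (metric_sym (ray_from q eta s)).
  have -> : t - s - (t + s) = - (2 * s) by ring.
  rewrite normrN ger0_norm; last by rewrite mulr_ge0// ltW.
  by move: close_s; lra.
have L2 : (t + u) ^+ 2 - 4 * k * t * u <= L ^+ 2.
  have h := cm_triangle_sqr GP q p z st01 su01.
  have h2 : (s * (2 - k)) ^+ 2 <= mdist (G q p (s / t)) (G q z (s / u)) ^+ 2.
    by rewrite ler_pXn2r ?nnegrE ?mdist_ge0// mulr_ge0 ?(ltW s0)//; lra.
  have {h2} := le_trans h2 h; rewrite (metric_sym q p) pq qz -/L.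
  (* clear the denominators t, u of the ratios and divide by s^2 *)
  have c0 : 0 < t * u / s ^+ 2 by rewrite divr_gt0 ?exprn_gt0// mulr_gt0.
  rewrite -(ler_pM2l c0).
  have -> : t * u / s ^+ 2 * (s * (2 - k)) ^+ 2 = t * u * (2 - k) ^+ 2.
    by field; rewrite gt_eqF.
  have -> : t * u / s ^+ 2 * (t ^+ 2 * ((s / t) ^+ 2 - s / t * (s / u)) +
      u ^+ 2 * ((s / u) ^+ 2 - s / t * (s / u)) + s / t * (s / u) * L ^+ 2) =
      2 * t * u - t ^+ 2 - u ^+ 2 + L ^+ 2.
    by field; rewrite !gt_eqF.
  by have := mulr_ge0 (mulr_ge0 (ltW t0) (ltW u0)) (sqr_ge0 k); lra.
set b := t / u in tue tu0 tu1 tu01.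
have tb : t = b * u by rewrite /b divfK// gt_eqF.
pose h := G p z b.
have qh : mdist q h <= e * t + b * t.
  apply: le_of_sqr; first by apply: addr_ge0; apply: mulr_ge0 => //; exact: ltW.
  have := cm_cn GP p z q tu01; rewrite (metric_sym q p) pq qz -/h -/L => h1.
  have b0' : 0 <= b * (1 - b) by rewrite mulr_ge0//; lra.
  have := ler_wpM2l b0' L2 => h2.
  have kE : 4 * k = e ^+ 2 by rewrite /k; field.
  have h3 : mdist q h ^+ 2 <= b ^+ 2 * t ^+ 2 + e ^+ 2 * t ^+ 2 * (1 - b).
    apply: le_trans h1 _; move: h2; rewrite kE tb.
    have -> : b * (1 - b) * ((b * u + u) ^+ 2 - e ^+ 2 * (b * u) * u) =
      u ^+ 2 * b * (1 + b - b ^+ 2 - b ^+ 3) - e ^+ 2 * (b * u) ^+ 2 * (1 - b) by ring.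
    by lra.
  apply: le_trans h3 _.
  have := mulr_ge0 (mulr_ge0 (ltW e0) tu0) (sqr_ge0 t).
  have := mulr_ge0 (mulr_ge0 (sqr_ge0 e) (sqr_ge0 t)) tu0.
  by lra.
have heta_t : mdist h (ray_from p eta t) <= b * K.
  rewrite (conicalG GP heta (t := u)) ?tu ?(ltW t0)//.
  apply: le_trans (cm_shared GP p _ _ tu01) _.
  by rewrite ler_wpM2l//; exact: hK (ltW u0).
apply: le_trans (metric_triangle _ h _) _.
apply: le_trans (lerD qh heta_t) _.
have tK : 0 <= t + K by lra.
have := ler_wpM2l tK tue; lra.
Qed.

(** The angle metric bounds the angle at each point from above, so the rays from
    q separate slowly for small times, by the law of cosines. *)
Lemma chord_of_angle_small e : 0 < e -> exists2 phi, 0 < phi &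
  forall xi eta, angle_metric xi eta < phi -> chord xi eta < e.
Proof.
move=> e0; pose e' := Num.min (e / 2) 1.
have e'0 : 0 < e' by rewrite lt_min ltr01 andbT; lra.
have e'1 : e' <= 1 by rewrite ge_min lexx orbT.
have e'e : e' <= e / 2 by rewrite ge_min lexx.
pose k := e' ^+ 2 / 4; have k0 : 0 < k by rewrite divr_gt0 ?exprn_gt0.
have k2 : 0 < k ^+ 2 by rewrite exprn_gt0.
have [phi /andP[phi0 phipi] hphi] := one_minus_cos_small k2.
exists phi => // xi eta ang.
apply: (@le_lt_trans _ _ e'); last lra.
apply: chord_of_rays_close; first by rewrite e'0.
move=> q; have := le_lt_trans (angle_at_le_metric GP proper p q xi eta) ang.
move=> /(angle_at_lt GP proper p) [r r0 hr]; exists r => // s sr.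
have /andP[s0 _] := sr; rewrite -/k.
have := comparison_angle_bounds GP proper p q xi eta s0 s0.
set w := _ / _ => -[/andP[w1 w2] wE].
have c2 : chord xi eta ^+ 2 <= 2 ^+ 2.
  by rewrite ler_pXn2r ?nnegrE ?chord_ge0 ?chord_le2.
have wi : -1 <= w <= 1 by rewrite w2 andbT; lra.
have := hr s sr; rewrite wE => lt.
have cw : cos phi < w.
  have : cos phi < cos (acos w).
    by rewrite ltr_cos// in_itv/= ?acos_ge0 ?acos_lepi ?phipi ?(ltW phi0).
  by rewrite acosK// in_itv.
have wE' : mdist (ray_from q xi s) (ray_from q eta s) ^+ 2 = 2 * s ^+ 2 * (1 - w).
  by rewrite /w; field; rewrite gt_eqF.
apply: le_of_sqr; first by rewrite mulr_ge0 ?(ltW k0) ?(ltW s0).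
rewrite wE' exprMn [leRHS]mulrC -mulrA mulrCA ler_wpM2l ?sqr_ge0//.
by lra.
Qed.

Local Notation tits := (tits_boundary X).

Lemma tits_open_nbhs (U : set tits) xi :
  nbhs (xi : tits) U <-> exists2 V : set tits,
    dist_open V & V xi /\ V `<=` U.
Proof.
rewrite nbhsE; split=> [[V [oV Vx] VU]|[V oV [Vx VU]]]; first by exists V.
by exists V.
Qed.

Lemma curve_length_le (T : choiceType) (D : T -> T -> R) (c : R -> T) k :
  0 <= k -> (forall s t, D (c s) (c t) <= k * `|s - t|) ->
  (curve_length (fun x y => (D x y)%:E) c <= k%:E)%E.
Proof.
move=> k0 lip; apply: ge_ereal_sup => _ [s [ps /eqP ls] ->].
have key (a : R) : path <%O a s ->
    (\sum_(0 <= i < size s) (D (c (nth 0 (a :: s) i)) (c (nth 0 (a :: s) i.+1)))%:E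
     <= (k * (last a s - a))%:E)%E.
  elim: s a {ps ls} => [|b s IH] a; first by rewrite /= big_geq// subrr mulr0.
  move=> /= /andP[ab pb]; rewrite big_nat_recl//=.
  have -> : (k * (last b s - a))%:E = ((k * (b - a))%:E + (k * (last b s - b))%:E)%E.
    by rewrite -EFinD; congr EFin; ring.
  apply: leeD; last exact: IH.
  rewrite lee_fin; apply: le_trans (lip _ _) _.
  by rewrite distrC gtr0_norm// subr_gt0.
by have := key 0 ps; rewrite ls subr0 mulr1.
Qed.

(** The trivial partition of a curve already has the length of its ends. *)
Lemma angle_le_tits xi eta : ((angle_metric xi eta)%:E <= tits_metric xi eta)%E.
Proof.
apply: le_ereal_inf_tmp => _ [c [_ c0 c1] <-].
apply: ereal_sup_ubound; exists [:: 1].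
  by split=> //=; rewrite ltr01.
by rewrite /= big_nat1/= c0 c1.
Qed.

(** J xi eta s is the direction of the point at ratio s of the geodesic from xi
    to eta in the Euclidean cone.  The chord bound 1 / 2 keeps that geodesic at
    distance at least 1 / 2 from the apex. *)
Lemma join_exists : exists J : ideal_boundary X -> ideal_boundary X -> R -> ideal_boundary X,
  (forall xi eta, chord xi eta <= 1 / 2 -> J xi eta 0 = xi /\ J xi eta 1 = eta) /\
  (forall xi eta xi' eta' s s', chord xi eta <= 1 / 2 -> chord xi' eta' <= 1 / 2 ->
     chord (J xi eta s) (J xi' eta' s') <=
       4 * (chord xi xi' + chord eta eta' + `|s - s'| * chord xi' eta')).
Proof.
have [CG CGP] := cone_convex GP proper p.
pose m xi eta s := CG (ray_cone xi) (ray_cone eta) (clamp s).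
have speed xi eta s : chord xi eta <= 1 / 2 -> 1 / 2 <= cone_speed (m xi eta s).
  move=> h; have /andP[c0 c1] := clamp_itv s.
  have h1 := cm_left CGP (ray_cone xi) (ray_cone eta) (clamp_itv s).
  have h2 := cone_speed_lip (ray_cone xi) (m xi eta s).
  have h3 := ler_wpM2r (chord_ge0 GP proper p xi eta) c1.
  move: h2; rewrite ler_norml /=; move: h1; rewrite -/(m _ _ _) -/(chord _ _); lra.
pose P (x : ideal_boundary X * ideal_boundary X * R) y :=
  chord x.1.1 x.1.2 <= 1 / 2 -> direction (m x.1.1 x.1.2 x.2) y.
have [|j jP] := @choice _ _ P.
  move=> [[xi eta] s]; rewrite /P /=.
  have [h|nh] := pselect (chord xi eta <= 1 / 2); last by exists xi.
  have v0 : 0 < cone_speed (m xi eta s) by have := speed xi eta s h; lra.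
  by have [zeta hz] := direction_exists GP proper v0; exists zeta.
have lip xi eta xi' eta' s s' : chord xi eta <= 1 / 2 -> chord xi' eta' <= 1 / 2 ->
    chord (j (xi, eta, s)) (j (xi', eta', s')) <=
      4 * (chord xi xi' + chord eta eta' + `|s - s'| * chord xi' eta').
  move=> h h'.
  have v := speed xi eta s h; have v' := speed xi' eta' s' h'.
  have v0 : 0 < cone_speed (m xi eta s) by lra.
  have v0' : 0 < cone_speed (m xi' eta' s') by lra.
  have := direction_lip GP proper v0 v0' (jP (xi, eta, s) h) (jP (xi', eta', s') h').
  have := cm_lip CGP (ray_cone xi) (ray_cone eta) (ray_cone xi') (ray_cone eta')
    (clamp_itv s) (clamp_itv s').
  rewrite -/(m _ _ _) -/(m _ _ _) -!/(chord _ _) => h1 h2.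
  have h3 := ler_wpM2r (chord_ge0 GP proper p xi' eta') (clamp_lip s s').
  have h4 := ler_wpM2r (chord_ge0 GP proper p (j (xi, eta, s)) (j (xi', eta', s'))) v.
  by lra.
exists (fun xi eta s => j (xi, eta, s)); split=> [xi eta h|//].
split.
- have v := speed xi eta 0 h.
  have v0 : 0 < cone_speed (m xi eta 0) by lra.
  have := direction_lip GP proper (m := ray_cone xi) ltr01 v0
    (direction_ray_cone GP proper p xi) (jP (xi, eta, 0) h).
  rewrite /m clamp0 /= mul1r => h1.
  have := cm_left CGP (ray_cone xi) (ray_cone eta) itv01_0; rewrite mul0r => h2.
  apply/esym/(chord0_eq (GP := GP) (proper := proper) (p := p))/eqP.
  by rewrite eq_le chord_ge0 andbT; lra.
- have v := speed xi eta 1 h.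
  have v0 : 0 < cone_speed (m xi eta 1) by lra.
  have := direction_lip GP proper (m := ray_cone eta) ltr01 v0
    (direction_ray_cone GP proper p eta) (jP (xi, eta, 1) h).
  rewrite /m clamp1 /= mul1r => h1.
  have := cm_right CGP (ray_cone xi) (ray_cone eta) itv01_1; rewrite subrr mul0r => h2.
  apply/esym/(chord0_eq (GP := GP) (proper := proper) (p := p))/eqP.
  by rewrite eq_le chord_ge0 andbT; lra.
Qed.

(** The curves J xi eta are Lipschitz for the angle metric, hence continuous and
    of length at most their Lipschitz constant. *)
Lemma tits_le_chord xi eta : chord xi eta <= 1 / 2 ->
  (tits_metric xi eta <= (8 / cos 1 * chord xi eta)%:E)%E.
Proof.
move=> h; have [J [J01 Jlip]] := join_exists.
have [J0 J1] := J01 xi eta h.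
have c1 := @cos1_gt0 R.
have ang s t : angle_metric (J xi eta s) (J xi eta t)
    <= 8 / cos 1 * chord xi eta * `|s - t|.
  apply: le_trans (angle_metric_chord GP proper p _ _) _.
  have := Jlip xi eta xi eta s t h h; rewrite !chordxx addr0 add0r => hl.
  have k0 : 0 <= 2 / cos 1 :> R by rewrite divr_ge0// ltW.
  by apply: le_trans (ler_wpM2l k0 hl) _; apply: le_of_eq; ring.
have K0 : 0 <= 8 / cos 1 * chord xi eta.
  by rewrite mulr_ge0 ?chord_ge0// divr_ge0// ltW.
apply: le_trans (curve_length_le (D := @angle_metric R X) K0 ang).
apply: ereal_inf_lbound; exists (J xi eta) => //; split=> //.
apply: continuous_subspaceT => s U; rewrite nbhsE => -[V [oV Vs] VU].
have [e e0 he] := oV _ Vs.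
pose k := e / (8 / cos 1 * chord xi eta + 1).
have k0 : 0 < k by rewrite divr_gt0//; lra.
change (\forall t \near s, U (J xi eta t)).
near=> t; apply/VU/he; rewrite lte_fin; apply: le_lt_trans (ang s t) _.
apply: (@le_lt_trans _ _ ((8 / cos 1 * chord xi eta) * k)).
  rewrite ler_wpM2l//; apply: ltW; near: t; exact: near_dist.
by rewrite /k mulrCA -[ltRHS]mulr1 ltr_pM2l// ltr_pdivrMr ?mul1r; lra.
Unshelve. all: by end_near. Qed.

Lemma tits_near xi e : 0 < e -> \forall eta \near (xi : tits), chord xi eta < e.
Proof.
move=> e0; apply/(tits_open_nbhs _ xi); exists [set eta | chord xi eta < e].
  2: by split=> //=; rewrite chordxx.
move=> eta /= h; have h0 : 0 < e - chord xi eta by rewrite subr_gt0.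
have [phi phi0 hphi] := chord_of_angle_small h0.
exists phi => // zeta hz; have /hphi : angle_metric eta zeta < phi.
  by have := le_lt_trans (angle_le_tits eta zeta) hz; rewrite lte_fin.
have := chord_triangle GP proper p eta xi zeta; lra.
Qed.

Lemma continuous_to_tits (A : topologicalType) (f : A -> tits) :
  (forall x e, 0 < e -> \forall y \near x, chord (f x) (f y) < e) -> continuous f.
Proof.
move=> h x U Ux; have [V oV [Vx VU]] := (tits_open_nbhs U (f x)).1 Ux.
have [e e0 he] := oV _ Vx; have c1 := @cos1_gt0 R.
have k0 : 0 < 8 / cos 1 :> R by rewrite divr_gt0.
have m0 : 0 < Num.min (1 / 2) (e / (8 / cos 1)) by rewrite lt_min !divr_gt0.
apply: filterS (h x _ m0) => y; rewrite lt_min => /andP[h1 h2].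
apply/VU/he; apply: le_lt_trans (tits_le_chord (ltW h1)) _.
by rewrite lte_fin mulrC -ltr_pdivlMr.
Qed.

End TitsTopology.

(** * Total boundedness and uniform convergence *)

Lemma compact_separated (R : realType) (Y : metricType R) (A : set Y) (d : R) :
  compact A -> 0 < d -> exists N, forall s : seq Y,
    (forall y, y \in s -> A y) ->
    pairwise (fun x y => d <= mdist x y) s -> (size s <= N)%N.
Proof.
move=> cA d0; have d2 : 0 < d / 2 by rewrite divr_gt0.
(* the filter of finite lists ordered by inclusion *)
pose F : set_system (seq Y) := [set S | exists D : seq Y,
  forall D' : seq Y, {subset D <= D'} -> S D'].
have FF : Filter F.
  split; first by exists [::].
  - move=> S S' [D hD] [D' hD']; exists (D ++ D') => E hE; split.
      by apply: hD => c cD; apply: hE; rewrite mem_cat cD.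
    by apply: hD' => c cD; apply: hE; rewrite mem_cat cD orbT.
  - by move=> S S' SS' [D hD]; exists D => E /hD /SS'.
have [D cov] : F [set D : seq Y | A `<=` [set y | exists2 c, c \in D & mdist c y < d / 2]].
  apply: ((compact_near_coveringP A).1 cA (seq Y) F (fun D y =>
    exists2 c, c \in D & mdist c y < d / 2) FF) => y _.
  exists ([set z | mdist y z < d / 2], [set D : seq Y | y \in D]) => /=.
    split; last by exists [:: y] => D; apply; rewrite mem_head.
    by apply/(@metricType_numDomainType.nbhs_mdistP R Y y); exists (d / 2).
  by move=> [z D] /= [zy yD]; exists y.
exists (size D) => s sA sep.
have inD y : y \in s -> exists2 c, c \in D & mdist c y < d / 2.
  by move=> /sA; exact: cov.
have [f fP] : exists f : Y -> Y, forall y, y \in s ->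
    f y \in D /\ mdist (f y) y < d / 2.
  have [|f fP] := @choice _ _ (fun y c => y \in s ->
      c \in D /\ mdist c y < d / 2).
    move=> y; have [ys|ys] := pselect (y \in s); last by exists y.
    by have [c cD hc] := inD y ys; exists c.
  by exists f.
have us : uniq s.
  by apply: pairwise_uniq sep => y; rewrite mdistxx leNgt d0.
have symsep : {in s &, forall x y, x != y -> d <= mdist x y}.
  elim: s sep {sA inD fP us} => // a s IH /= /andP[/allP ha hs] x y.
  rewrite !inE => /orP[/eqP->|xs] /orP[/eqP->|ys]; first by rewrite eqxx.
  - by move=> _; exact: ha.
  - by move=> _; rewrite metric_sym; exact: ha.
  - exact: IH.
rewrite -(size_map f); apply: uniq_leq_size.
  rewrite map_inj_in_uniq// => x y xs ys fxy; apply/eqP; apply: contraT => xy.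
  have := symsep x y xs ys xy; rewrite leNgt => /negP[].
  have [_ hx] := fP x xs; have [_ hy] := fP y ys.
  apply: le_lt_trans (metric_triangle _ (f x) _) _.
  by rewrite (metric_sym x) {2}fxy; lra.
by move=> c /mapP[y ys ->]; have [] := fP y ys.
Qed.

Lemma eventually_seq (R : realType) (A : eqType) (P : A -> R -> Prop) (l : seq A) :
  (forall a, a \in l -> exists2 T, 0 < T & forall t, T <= t -> P a t) ->
  exists2 T, 0 < T & forall t, T <= t -> forall a, a \in l -> P a t.
Proof.
elim: l => [|a l IH] h; first by exists 1.
have [|T1 T10 h1] := IH; first by move=> b bl; apply: h; rewrite inE bl orbT.
have [T2 T20 h2] := h a (mem_head _ _).
exists (T1 + T2) => [|t Tt b]; first by rewrite addr_gt0.
rewrite inE => /orP[/eqP->|bl]; first by apply: h2; lra.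
by apply: h1 => //; lra.
Qed.

Section TotallyBounded.
Context {R : realType} (X : metricType R) (G : X -> X -> R -> X).
Hypothesis GP : convex_metric mdist G.
Hypothesis proper : proper_space X.
Variable p : X.
Implicit Types (xi eta zeta : ideal_boundary X) (s t u v : R).
Notation chord := (@chord R X G GP proper p).
Notation ray_cone := (@ray_cone R X G GP proper p).

Lemma chord_approx xi eta e : 0 < e -> exists2 T, 0 < T & forall t, T <= t ->
  (chord xi eta - e) * t <= mdist (ray_from p xi t) (ray_from p eta t).
Proof. by move=> e0; exact: (cdist_approx GP (ray_cone xi) (ray_cone eta) e0). Qed.

Lemma separated_eventually (l : seq (ideal_boundary X)) r : 0 < r ->
  pairwise (fun xi eta => r <= chord xi eta) l ->
  exists2 T, 0 < T & forall t, T <= t -> pairwise (fun xi eta =>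
    r / 2 * t <= mdist (ray_from p xi t) (ray_from p eta t)) l.
Proof.
move=> r0; elim: l => [_|xi l IH /= /andP[/allP hxi /IH[T1 T10 h1]]]; first by exists 1.
have r2 : 0 < r / 2 by lra.
have [|T2 T20 h2] := @eventually_seq R _ (fun eta t =>
    r / 2 * t <= mdist (ray_from p xi t) (ray_from p eta t)) l.
  move=> eta el; have [T T0 hT] := chord_approx xi eta r2; exists T => // t Tt.
  apply: le_trans (hT t Tt); rewrite ler_wpM2r//; first by apply: le_trans Tt; exact: ltW.
  by have := hxi eta el; lra.
exists (T1 + T2) => [|t Tt]; first by rewrite addr_gt0.
rewrite h1 ?andbT; last lra.
by apply/allP => eta el; apply: h2 => //; lra.
Qed.

Lemma separated_of_no_net r :
  ~ (exists l : seq (ideal_boundary X), forall eta,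
       exists2 xi, xi \in l & chord eta xi < r) ->
  forall n, exists2 l : seq (ideal_boundary X), size l = n &
    pairwise (fun xi eta => r <= chord xi eta) l.
Proof.
move=> none; elim=> [|n [l sl hl]]; first by exists [::].
have [eta heta] : exists eta, forall xi, xi \in l -> r <= chord eta xi.
  apply: contrapT => h; apply: none; exists l => eta; apply: contrapT => h'.
  apply: h; exists eta => xi xl; rewrite leNgt; apply/negP => lt; apply: h'.
  by exists xi.
by exists (eta :: l); rewrite /= ?sl ?hl ?andbT//; apply/allP.
Qed.

(** Otherwise, for every n there are n ideal points at mutual chord distance at
    least r, and at a late time t_n the n points of their rays are at mutual
    distance at least r t_n / 2.  A limit of the spaces X / t_n would contain,
    in a fixed ball, arbitrarily many points at mutual distance r / 4. *)
Lemma boundary_totally_bounded r : has_asymptotic_cone X -> 0 < r ->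
  exists l : seq (ideal_boundary X), forall eta,
    exists2 xi, xi \in l & chord eta xi < r.
Proof.
move=> [w [lim _]] r0; apply: contrapT => none.
have big n : exists lt : seq (ideal_boundary X) * R, [/\ size lt.1 = n, n.+1%:R <= lt.2 &
    pairwise (fun xi eta =>
      r / 2 * lt.2 <= mdist (ray_from p xi lt.2) (ray_from p eta lt.2)) lt.1].
  have [l sl hl] := separated_of_no_net none n.
  have [T T0 hT] := separated_eventually r0 hl.
  exists (l, T + n.+1%:R); split=> //=; first by rewrite lerDr ltW.
  by apply: hT; rewrite lerDl.
have [f fP] := choice big.
pose t n := (f n).2.
have t1 n : n.+1%:R <= t n by have [] := fP n.
have t0 n : 0 < t n by apply: lt_le_trans (t1 n); rewrite ltr0n.
have ti0 n : 0 < (t n)^-1 by rewrite invr_gt0.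
pose lam n : {posnum R} := PosNum (ti0 n).
have lam0 : (lam n)%:num @[n --> \oo] --> (0 : R).
  apply: (@squeeze_cvgr _ _ _ _ (fun=> 0) (@harmonic R)); last 2 first.
  - exact: cvg_cst.
  - exact: cvg_harmonic.
  apply: nearW => n /=; rewrite ltW//= lef_pV2 ?posrE//.
have [Y [q [Yproper _ gh]]] := lim lam lam0.
(* as t_n >= 1, the rescaled ball of this radius about w contains the points at
   time t_n of all rays from p *)
pose rad := mdist w p + 1.
have rad0 : 0 < rad by rewrite ltr_wpDl// mdist_ge0.
have [eps [phi [eps0 appr]]] := gh rad rad0.
have r4 : 0 < r / 4 by lra.
have [N hN] := compact_separated (@mcball_compact _ _ Yproper q rad) r4.
have r16 : 0 < r / 16 by lra.
have [n [Nn en]] : exists n, (N < n)%N /\ eps n < r / 16.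
  have /cvgrPdist_lt /(_ _ r16) := eps0.
  move=> near_eps; near \oo => n; exists n; split; first by near: n; exact: nbhs_infty_gt.
  have : `|0 - eps n| < r / 16 by near: n.
  by rewrite sub0r normrN => /(le_lt_trans (ler_norm _)).
have [sl _ sep] := fP n; have [_ [phi_in phi_sur phi_dist]] := appr n.
set l := (f n).1 in sl sep.
have rd (x y : rescale (lam n) X) : mdist x y = (t n)^-1 * mdist (x : X) (y : X) by [].
pose z xi : rescale (lam n) X := ray_from p xi (t n).
have zin xi : mcball (w : rescale (lam n) X) rad (z xi).
  rewrite /mcball /= rd /z; apply: (@le_trans _ _ ((t n)^-1 * (mdist w p + t n))).
    rewrite ler_wpM2l ?(ltW (ti0 n))//; apply: le_trans (metric_triangle _ p _) _.
    by rewrite (conical_dist (ray_from_conical GP proper p xi) (ltW (t0 n))) mul1r.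
  rewrite mulrDr mulVf ?gt_eqF// lerD2r ler_piMl ?mdist_ge0// invf_le1//.
  by apply: le_trans (t1 n); rewrite ler1n.
have [g gP] : exists g : ideal_boundary X -> Y, forall xi,
    mcball q rad (g xi) /\ mdist (phi n (g xi)) (z xi) < eps n.
  have [|g gP] := @choice _ _ (fun xi y => mcball q rad y /\ mdist (phi n y) (z xi) < eps n).
    by move=> xi; have [y yq hy] := phi_sur _ (zin xi); exists y.
  by exists g.
have := hN (map g l); rewrite size_map sl leqNgt Nn => /(_ _ _) H.
suff : false by [].
apply: H.
  by move=> y /mapP[xi _ ->]; have [] := gP xi.
rewrite pairwise_map; apply: sub_pairwise sep => xi eta /= h.
have [gx hx] := gP xi; have [gy hy] := gP eta.
have hz : r / 2 <= mdist (z xi) (z eta).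
  by rewrite rd [leRHS]mulrC ler_pdivlMr.
have := phi_dist _ _ gx gy; have := mdist_lip2 (phi n (g xi)) (phi n (g eta)) (z xi) (z eta).
by rewrite ler_norml ltr_norml; lra.
Unshelve. all: by end_near. Qed.

(** Since d(xi(t), eta(t)) / t increases to the chord, it is enough to wait until
    it is close to its limit for the finitely many pairs of an r / 8 net: any
    other point of the boundary is near one of the net, at every time. *)
Lemma uniform_net r : has_asymptotic_cone X -> 0 < r ->
  exists (l : seq (ideal_boundary X)) (T : R), 0 < T /\ forall t, T <= t ->
    (forall eta, exists2 xi, xi \in l &
       mdist (ray_from p eta t) (ray_from p xi t) < r / 2 * t) /\
    (forall eta xi, xi \in l ->
       mdist (ray_from p eta t) (ray_from p xi t) < r / 2 * t -> chord eta xi < r).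
Proof.
move=> cone r0; have r8 : 0 < r / 8 by lra.
have [l net] := boundary_totally_bounded cone r8.
have [|T T0 hT] := @eventually_seq R _ (fun zeta t => forall xi, xi \in l ->
    (chord zeta xi - r / 8) * t <= mdist (ray_from p zeta t) (ray_from p xi t)) l.
  by move=> zeta _; apply: eventually_seq => xi _; exact: chord_approx.
exists l, T; split=> // t Tt; have t0 : 0 < t by exact: lt_le_trans Tt.
have up eta xi := ray_dist_le GP proper p p eta xi (ltW t0).
split=> [eta|eta xi xl h].
  have [xi xl h] := net eta; exists xi => //; apply: le_lt_trans (up _ _) _.
  by rewrite ltr_pM2r//; lra.
have [zeta zl hz] := net eta.
have h1 := hT t Tt zeta zl xi xl.
have h2 := metric_triangle (ray_from p zeta t) (ray_from p eta t) (ray_from p xi t).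
have h3 := up zeta eta.
have h4 : chord zeta xi - r / 8 < r / 8 + r / 2.
  rewrite -(ltr_pM2r t0); apply: le_lt_trans h1 _; apply: le_lt_trans h2 _.
  rewrite mulrDl; apply: ler_ltD => //; apply: le_trans h3 _.
  by rewrite ler_wpM2r ?(ltW t0)// chord_sym ltW.
have := chord_triangle GP proper p zeta eta xi; lra.
Qed.

End TotallyBounded.

(** * Homotopy equivalence of large spheres with the Tits boundary *)

Lemma continuous_dist (R : realType) (A : topologicalType) (f : A -> R) :
  (forall x e, 0 < e -> \forall y \near x, `|f x - f y| < e) -> continuous f.
Proof. by move=> h x; apply/cvgrPdist_lt => e; exact: h. Qed.

Section SubsetTopology.
Context {R : realType} (X : metricType R) (A : set X).

Lemma subset_near (x : A) e : 0 < e -> \forall y \near x, mdist (val x) (val y) < e.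
Proof.
move=> e0; have := @initial_continuous A X set_val x.
by move=> /(@metricType_numDomainType.cvgrPdist_lt R X) /(_ e e0).
Qed.

Lemma continuous_to_subset (B : topologicalType) (f : B -> A) :
  (forall x e, 0 < e -> \forall y \near x, mdist (val (f x)) (val (f y)) < e) ->
  continuous f.
Proof.
move=> h x U; rewrite nbhsE => -[V [[W oW WV] Vx] VU].
have /(@metricType_numDomainType.nbhs_mdistP R X) [e /= e0 he] : nbhs (val (f x)) W.
  by apply: open_nbhs_nbhs; split=> //; move: Vx; rewrite -WV.
by apply: filterS (h x e e0) => y hy; apply: VU; rewrite -WV; exact: he.
Qed.

Lemma subset_lip_continuous (f : A -> R) :
  (forall x y, `|f x - f y| <= mdist (val x) (val y)) -> continuous f.
Proof.
move=> lip; apply: continuous_dist => x e e0.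
near=> y; apply: le_lt_trans (lip x y) _; near: y; exact: subset_near.
Unshelve. all: by end_near. Qed.

End SubsetTopology.

Lemma near_fst (A B : topologicalType) (a : A) (b : B) (P : A -> Prop) :
  (\forall x \near a, P x) -> \forall z \near (a, b), P z.1.
Proof. by move=> h; exact: (@cvg_fst _ _ (nbhs a) (nbhs b) _ _ h). Qed.

Lemma near_snd (A B : topologicalType) (a : A) (b : B) (P : B -> Prop) :
  (\forall x \near b, P x) -> \forall z \near (a, b), P z.2.
Proof. by move=> h; exact: (@cvg_snd _ _ (nbhs a) (nbhs b) _ _ h). Qed.

Lemma max0_lip (R : realType) (a b : R) : `|Num.max 0 a - Num.max 0 b| <= `|a - b|.
Proof.
rewrite ler_norml; have : - `|a - b| <= a - b <= `|a - b| by rewrite -ler_norml.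
have := normr_ge0 (a - b); move: `|_| => u.
by case: (leP 0 a) => ?; case: (leP 0 b) => ?; lra.
Qed.

(** ** Radial projection onto a sphere from outside *)

Section RadialProjection.
Context {R : realType} (X : metricType R) (G : X -> X -> R -> X).
Hypothesis GP : convex_metric mdist G.
Variables (p : X) (t : R).
Hypothesis t0 : 0 < t.

Definition radial (w : X) : X := G p w (t / mdist p w).

Let ratio_itv w : t <= mdist p w -> 0 <= t / mdist p w <= 1.
Proof.
move=> tw; have w0 : 0 < mdist p w by exact: lt_le_trans tw.
by rewrite divr_ge0 ?mdist_ge0 ?(ltW t0)//= ler_pdivrMr// mul1r.
Qed.

Lemma radial_dist w : t <= mdist p w -> mdist p (radial w) = t.
Proof.
move=> tw; rewrite (cm_left_eq GP) ?ratio_itv// divfK// gt_eqF//.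
exact: lt_le_trans tw.
Qed.

Lemma radial_lip w w' : t <= mdist p w -> t <= mdist p w' ->
  mdist (radial w) (radial w') <= 2 * mdist w w'.
Proof.
move=> tw tw'; have r01 := ratio_itv tw; have r01' := ratio_itv tw'.
have w0 : 0 < mdist p w by exact: lt_le_trans tw.
have w0' : 0 < mdist p w' by exact: lt_le_trans tw'.
apply: le_trans (metric_triangle _ (G p w' (t / mdist p w)) _) _.
have h1 : mdist (radial w) (G p w' (t / mdist p w)) <= mdist w w'.
  apply: le_trans (cm_shared GP _ _ _ r01) _; rewrite ler_piMl ?mdist_ge0//.
  by have /andP[] := r01.
have h2 : mdist (G p w' (t / mdist p w)) (radial w') <= mdist w w'.
  rewrite (cm_param_eq GP) //.
  have -> : t / mdist p w - t / mdist p w' =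
      (mdist p w' - mdist p w) * (t / mdist p w) / mdist p w'.
    by field; rewrite !gt_eqF.
  rewrite normrM normrM (gtr0_norm (x := _^-1)) ?invr_gt0// divfK ?gt_eqF//.
  have := mdist_lip2 p w' p w; rewrite mdistxx add0r (metric_sym w') => h.
  have /andP[r0 r1] := r01; rewrite (ger0_norm r0).
  apply: le_trans h; rewrite ler_piMr//.
by apply: le_trans (lerD h1 h2) _; lra.
Qed.

Lemma radial_fix w : mdist p w = t -> radial w = w.
Proof.
move=> wt; rewrite /radial wt divff ?gt_eqF//; apply/esym/mdist_positivity/eqP.
rewrite eq_le mdist_ge0 andbT.
by have := cm_right GP p w itv01_1; rewrite subrr mul0r.
Qed.

End RadialProjection.

(** ** The two homotopies *)

Section SphereEquivalence.
Context {R : realType} (X : metricType R) (G : X -> X -> R -> X).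
Hypothesis GP : convex_metric mdist G.
Hypothesis proper : proper_space X.
Variables (p : X) (t : R).
Hypothesis t0 : 0 < t.
Implicit Types (xi eta zeta : ideal_boundary X).
Notation chord := (@chord R X G GP proper p).
Notation ray_cone := (@ray_cone R X G GP proper p).
Notation S := (msphere p t).

Hypothesis surj : forall x, mdist p x = t -> exists eta, ray_from p eta t = x.
Variable l : seq (ideal_boundary X).
Hypothesis net : forall eta, exists2 xi, xi \in l &
  mdist (ray_from p eta t) (ray_from p xi t) < 1 / 8 / 2 * t.
Hypothesis net_chord : forall eta xi, xi \in l ->
  mdist (ray_from p eta t) (ray_from p xi t) < 1 / 8 / 2 * t -> chord eta xi < 1 / 8.

Lemma sphereP (x : S) : mdist p (val x) = t.
Proof. exact: set_mem (valP x). Qed.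

Definition sphere_of (x : X) (h : mdist p x = t) : S := exist _ x (mem_set h).

(** phi x is the direction of the mean, in the Euclidean cone, of the net points
    whose rays are near x at time t.  Balls of the cone are convex, so the mean
    is within 1 / 8 of eta whenever x = eta(t), in particular far from the apex. *)
Lemma boundary_section : exists phi : S -> ideal_boundary X,
  (forall x e, 0 < e -> \forall y \near x, chord (phi x) (phi y) < e) /\
  (forall x eta, ray_from p eta t = val x -> chord eta (phi x) <= 1 / 4).
Proof.
have [CG CGP] := cone_convex GP proper p.
pose wgt xi (x : S) := Num.max 0 (1 / 8 / 2 * t - mdist (val x) (ray_from p xi t)).
have x0P : conical p 0 (fun=> p) by split=> // *; rewrite mdistxx mul0r.
pose x0 := Cone x0P.
pose L : seq (cone p * (S -> R)) := [seq (ray_cone xi, wgt xi) | xi <- l].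
have LP i : List.In i L -> exists2 xi, xi \in l & i = (ray_cone xi, wgt xi).
  rewrite /L; elim: (l) => //= a l' IH [<-|/IH[xi xl ->]].
    by exists a; rewrite ?mem_head.
  by exists xi; rewrite // inE xl orbT.
have L0 i : List.In i L -> forall x, 0 <= i.2 x.
  by move=> /LP[xi _ ->] x /=; rewrite le_max lexx.
have Lc i : List.In i L -> continuous i.2.
  move=> /LP[xi _ ->]; apply: subset_lip_continuous => x y.
  apply: le_trans (max0_lip _ _) _.
  set r := ray_from p xi t; set a := 1 / 8 / 2 * t.
  have -> : a - mdist (val x) r - (a - mdist (val y) r) =
    mdist (val y) r - mdist (val x) r by ring.
  by have := mdist_lip2 (val y) r (val x) r; rewrite mdistxx addr0 (metric_sym (val y) (val x)).
have Wpos x : 0 < wt L x.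
  have [eta etax] := surj (sphereP x); have [xi xl] := net eta; rewrite etax => hxi.
  rewrite /wt /L; elim: (l) xl => // a l' IH; rewrite inE big_cons /= => h.
  have a0 b : 0 <= wgt b x by rewrite le_max lexx.
  have s0 : 0 <= \sum_(j <- [seq (ray_cone b, wgt b) | b <- l']) j.2 x.
    by rewrite big_map; apply: sumr_ge0 => c _; exact: a0.
  move: h => /orP[/eqP<-|/IH h]; last by rewrite ltr_wpDl.
  by rewrite ltr_wpDr// lt_max subr_gt0 hxi orbT.
pose b := bary CG x0 L.
have bnear x eta : ray_from p eta t = val x -> cdist (ray_cone eta) (b x) <= 1 / 8.
  move=> etax; apply: (bary_ball CGP) => // [i il|i /LP[xi xl ->] /=]; first exact: L0.
  rewrite lt_max ltxx subr_gt0 /= -etax => h.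
  by apply: ltW; exact: net_chord h.
have speed x : 7 / 8 <= cone_speed (b x).
  have [eta etax] := surj (sphereP x).
  have := cone_speed_lip (ray_cone eta) (b x); have := bnear x eta etax.
  by rewrite ler_norml /=; lra.
have speed0 x : 0 < cone_speed (b x) by have := speed x; lra.
have [phi phiP] := choice (fun x => direction_exists GP proper (speed0 x)).
exists phi; split=> [x e e0|x eta etax].
  have e4 : 0 < e / 4 by lra.
  have bc : \forall y \near x, cdist (b x) (b y) < e / 4 by exact: bary_cont.
  apply: filterS bc => y hy.
  have := direction_lip GP proper (speed0 x) (speed0 y) (phiP x) (phiP y).
  have := ler_wpM2r (chord_ge0 GP proper p (phi x) (phi y)) (speed x); lra.
have := direction_lip GP proper (m := ray_cone eta) ltr01 (speed0 x)
  (direction_ray_cone GP proper p eta) (phiP x).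
have := bnear x eta etax; rewrite /= mul1r; lra.
Qed.

Lemma ray_sphere xi : mdist p (ray_from p xi t) = t.
Proof. by rewrite (conical_dist (ray_from_conical GP proper p xi) (ltW t0)) mul1r. Qed.

Definition ray_point (xi : tits_boundary X) : S := sphere_of (ray_sphere xi).

Lemma ray_point_continuous : continuous ray_point.
Proof.
apply: continuous_to_subset => xi e e0; have et : 0 < e / t by rewrite divr_gt0.
near=> eta; have h : chord xi eta < e / t by near: eta; exact: tits_near.
apply: le_lt_trans (ray_dist_le GP proper p p xi eta (ltW t0)) _.
by rewrite -ltr_pdivlMr.
Unshelve. all: by end_near. Qed.

Lemma sphere_tits_equivalent : homotopy_equivalent R S (tits_boundary X).
Proof.
have [phi [phi_near phi_close]] := boundary_section.
have [J [J01 Jlip]] := join_exists GP proper p.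
have hray xi := ray_from_conical GP proper p xi.
pose E := ray_point; have E_cont : continuous E := ray_point_continuous.
have phi_cont : continuous (phi : S -> tits_boundary X).
  by apply: (continuous_to_tits (GP := GP) (proper := proper) (p := p)) => x e; exact: phi_near.
have close xi : chord (phi (E xi)) xi <= 1 / 4.
  by rewrite chord_sym; exact: phi_close.
have close2 xi : chord (phi (E xi)) xi <= 1 / 2 by have := close xi; lra.
exists phi, E; split=> //.
- pose z x := ray_from p (phi x) (2 * t).
  have t2 : 0 <= 2 * t by rewrite mulr_ge0// ltW.
  have zd x : mdist p (z x) = 2 * t by rewrite (conical_dist (hray _) t2) mul1r.
  pose w (xs : S * R) := G (z xs.1) (val xs.1) (clamp xs.2).
  (* With y = eta(2t), the point at ratio s from y to x is at distance
     t + (1 - s) t from p, and w is within (1 - s) d(z, y) <= (1 - s) t / 2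
     of it. *)
  have far xs : t <= mdist p (w xs).
    case: xs => x s; rewrite /w /=; have := clamp_itv s; move: (clamp s) => {}s s01.
    have /andP[s0 s1] := s01.
    have [eta etax] := surj (sphereP x).
    pose y := ray_from p eta (2 * t).
    have [_ _ iso] := hray eta.
    have zy : mdist (z x) y <= 1 / 4 * (2 * t).
      apply: le_trans (ray_dist_le GP proper p p _ _ t2) _.
      by rewrite ler_wpM2r// chord_sym; exact: phi_close.
    have h1 : mdist (G (z x) (val x) s) (G y (val x) s) <= (1 - s) * (1 / 4 * (2 * t)).
      apply: le_trans (cm_convex GP _ _ _ _ s01) _.
      by rewrite mdistxx mulr0 addr0 ler_wpM2l//; lra.
    have ts0 : 0 <= (1 - s) * t by rewrite mulr_ge0 ?(ltW t0)//; lra.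
    have tts : 0 <= t + (1 - s) * t by rewrite addr_ge0// ltW.
    have yx : mdist y (val x) = t.
      by rewrite -etax iso ?(ltW t0)// mul1r ger0_norm; lra.
    have h2 : ray_from p eta (t + (1 - s) * t) = G y (val x) s.
      have st0 : 0 <= s * t by rewrite mulr_ge0// ltW.
      apply: mdist_positivity; apply: (cm_unique GP) => //; rewrite yx.
      + by rewrite iso// mul1r ger0_norm; lra.
      + by rewrite -etax iso ?(ltW t0)// mul1r ler0_norm; lra.
    have h3 : mdist p (G y (val x) s) = t + (1 - s) * t.
      by rewrite -h2 (conical_dist (hray eta) tts) mul1r.
    have := metric_triangle p (G (z x) (val x) s) (G y (val x) s).
    by rewrite h3; lra.
  have rP xs : mdist p (radial G p t (w xs)) = t by exact: radial_dist.
  exists (fun xs => sphere_of (rP xs)); split.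
  + apply/continuous_subspaceT/continuous_to_subset => -[x s] e e0 /=.
    (* radial is 2-Lipschitz and the variation of w is at most 5 k t + e / 6 *)
    pose k := e / (30 * t).
    have k0 : 0 < k by rewrite divr_gt0// mulr_gt0.
    have e6 : 0 < e / 6 by lra.
    near=> ys.
    have h1 : chord (phi x) (phi ys.1) < k.
      by near: ys; exact: (near_fst s (phi_near x k k0)).
    have h2 : mdist (val x) (val ys.1) < e / 6.
      by near: ys; exact: (near_fst s (subset_near x e6)).
    have h3 : `|s - ys.2| < k by near: ys; exact: (near_snd x (near_dist s k0)).
    apply: le_lt_trans (radial_lip GP t0 (far _) (far _)) _.
    have hz : mdist (z x) (z ys.1) <= k * (2 * t).
      apply: le_trans (ray_dist_le GP proper p p _ _ t2) _.
      by rewrite ler_wpM2r// ltW.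
    have hzx : mdist (z ys.1) (val ys.1) <= 3 * t.
      apply: le_trans (metric_triangle _ p _) _.
      by rewrite (metric_sym _ p) zd sphereP; lra.
    have := cm_lip GP (z x) (val x) (z ys.1) (val ys.1) (clamp_itv s) (clamp_itv ys.2).
    rewrite -/(w (x, s)) -/(w ys) => hw.
    have kt : k * (30 * t) = e by rewrite divfK// gt_eqF// mulr_gt0.
    have hc : `|clamp s - clamp ys.2| <= k by apply: le_trans (clamp_lip _ _) _; exact: ltW.
    have hm : `|clamp s - clamp ys.2| * mdist (z ys.1) (val ys.1) <= k * (3 * t).
      by apply: ler_pM => //; exact: mdist_ge0.
    lra.
  + move=> x; apply: val_inj => /=; rewrite /w /= clamp0.
    have -> : G (z x) (val x) 0 = z x.
      apply/esym/mdist_positivity/eqP; rewrite eq_le mdist_ge0 andbT.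
      by have := cm_left GP (z x) (val x) itv01_0; rewrite mul0r.
    rewrite /radial zd; apply/esym; apply: (conicalG GP (hray _)).
      by rewrite ltW//=; lra.
    by rewrite mulr_gt0.
  + move=> x; apply: val_inj => /=; rewrite /w /= clamp1.
    have -> : G (z x) (val x) 1 = val x.
      apply/esym/mdist_positivity/eqP; rewrite eq_le mdist_ge0 andbT.
      by have := cm_right GP (z x) (val x) itv01_1; rewrite subrr mul0r.
    by apply: radial_fix => //; exact: sphereP.
- exists (fun xs => J (phi (E xs.1)) xs.1 xs.2); split.
  + apply/continuous_subspaceT/(continuous_to_tits (GP := GP) (proper := proper) (p := p)) => -[xi s] e e0 /=.
    have e12 : 0 < e / 12 by lra.
    near=> ys.
    have h1 : chord (phi (E xi)) (phi (E ys.1)) < e / 12.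
      near: ys; apply: (near_fst s (P := fun y => chord (phi (E xi)) (phi (E y)) < e / 12)).
      exact: (E_cont xi _ (phi_near (E xi) _ e12)).
    have h2 : chord xi ys.1 < e / 12.
      near: ys; exact: (near_fst (A := tits_boundary X) s (tits_near GP proper p xi e12)).
    have h3 : `|s - ys.2| < e / 12.
      by near: ys; exact: (near_snd (xi : tits_boundary X) (near_dist s e12)).
    apply: le_lt_trans (Jlip _ _ _ _ s ys.2 (close2 _) (close2 _)) _.
    have hm : `|s - ys.2| * chord (phi (E ys.1)) ys.1 <= e / 12 * 1.
      apply: ler_pM => //; [exact: chord_ge0|exact: ltW|].
      by have := close2 ys.1; lra.
    lra.
  + by move=> xi; have [] := J01 _ _ (close2 xi).
  + by move=> xi; have [] := J01 _ _ (close2 xi).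
Unshelve. all: by end_near. Qed.

End SphereEquivalence.

Theorem theorem4p6 (R : realType) (X : metricType R)
  (X_proper : proper_space X)
  (X_complete : geodesically_complete X)
  (X_cat0 : cat0_space X)
  (X_cone : has_asymptotic_cone X)
  (p : X) :
  exists2 t0 : R, 0 < t0 &
    forall t : R, t0 <= t ->
      homotopy_equivalent R (msphere p t) (tits_boundary X).
Proof.
have [G GP] := cat0_convex_metric X_cat0.
have r8 : 0 < (1 / 8 : R) by lra.
have [l [T [T0 hT]]] := uniform_net GP X_proper p X_cone r8.
exists T => // t Tt; have t0 : 0 < t by exact: lt_le_trans Tt.
have [net net_chord] := hT t Tt.
apply: (sphere_tits_equivalent t0 _ net net_chord) => x xt.
have px : p != x by rewrite -mdist_gt0 xt.
have [c [iso c0 cx]] := geodesic_extends_to_ray X_cat0 X_complete px.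
have hc : conical p 1 c.
  by split=> // s u s0 u0; rewrite mul1r iso//= in_itv/= andbT.
have [eta etac] := conical_ray_from GP X_proper hc.
by exists eta; rewrite etac ?(ltW t0)// -xt.
Qed.
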